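(* Let $H$ be a complex Hilbert space, and let $(a,j)$ be a quasi-sectorial form in $H$. For each $n\in\mathbb{N}$ let $a_n$ be a sesquilinear form whose domain $\operatorname{dom}(a_n)$ is a linear subspace of $\operatorname{dom}(a)$. Let $\theta\in[0,\frac{\pi}{2})$, and assume that $$a_n(u)-a(u)\in\overline{\Sigma_\theta}\qquad(u\in\operatorname{dom}(a_n),\ n\in\mathbb{N}).$$ Let $D$ be a core for $a$, and suppose that for all $u\in D$ there exists a sequence $(u_n)_{n\in\mathbb{N}}$ in $\operatorname{dom}(a)$ with $u_n\in\operatorname{dom}(a_n)$ for all $n\in\mathbb{N}$, such that $u_n\to u$ in $\operatorname{dom}(a)$ and $a_n(u_n)-a(u_n)\to0$ as $n\to\infty$. Let $A$ be the linear relation associated with $(a,j)$, and for $n\in\mathbb{N}$ let $A_n$ be the linear relation associated with $(a_n,j|_{\operatorname{dom}(a_n)})$. Denote by $T$ the degenerate strongly continuous semigroup generated by $-A$, and for $n\in\mathbb{N}$ denote by $T_n$ the degenerate strongly continuous semigroup generated by $-A_n$. Then, for all $x\in H$, $$T_n(t)x\to T(t)x\qquad(n\to\infty)$$ uniformly for $t$ in compact subsets of $[0,\infty)$.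
   Context: Sesquilinear forms are linear in the first and antilinear in the second argument, as is the scalar product $(\cdot\mid\cdot)_H$ of $H$. For a sesquilinear form $a$ on a complex vector space $\operatorname{dom}(a)$ write $a(u):=a(u,u)$ and $(\operatorname{Re}a)(x,y):=\frac12\bigl(a(x,y)+\overline{a(y,x)}\bigr)$. For $\theta\in[0,\pi/2)$ let $\Sigma_\theta:=\{re^{i\alpha};\ r>0,\ \alpha\in(-\theta,\theta)\cup\{0\}\}\subseteq\mathbb{C}$, with closure $\overline{\Sigma_\theta}$. **Forms in $H$.** A form in $H$ is a couple $(a,j)$, where $a$ is a sesquilinear form on a complex vector space $\operatorname{dom}(a)$ and $j\colon\operatorname{dom}(a)\to H$ is linear (no density of $\operatorname{ran}(j)$, no injectivity of $j$, and no closedness or closability is assumed). It is quasi-sectorial of angle $\theta\in[0,\pi/2)$ with vertex $\gamma\in\mathbb{R}$ if $a(u)-\gamma\|j(u)\|_H^2\in\overline{\Sigma_\theta}$ for all $u\in\operatorname{dom}(a)$. It is called quasi-sectorial if this holds for some angle in $[0,\pi/2)$ and some vertex $\gamma\in\mathbb{R}$. It is sectorial if $a(u)\in\overline{\Sigma_\theta}$ for all $u\in\operatorname{dom}(a)$, for some $\theta\in[0,\pi/2)$. **Topology of $\operatorname{dom}(a)$.** If $(a,j)$ is quasi-sectorial with vertex $\gamma$, then $\operatorname{dom}(a)$ is equipped with the semi-inner product $(x\mid y)_{a_{-\gamma},j}:=(\operatorname{Re}a)(x,y)+(1-\gamma)(j(x)\mid j(y))_H$ and the corresponding seminorm (different vertices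 give equivalent seminorms). Convergence $u_n\to u$ in $\operatorname{dom}(a)$ is with respect to this seminorm. A core for $a$ is a linear subspace of $\operatorname{dom}(a)$ that is dense with respect to this seminorm. **Associated linear relation.** A linear relation in $H$ is a linear subspace of $H\times H$. First let $(a,j)$ be sectorial. Let $(V,q)$ be the completion of $\operatorname{dom}(a)$ with respect to the semi-inner product $(x\mid y)_{a,j}:=(\operatorname{Re}a)(x,y)+(j(x)\mid j(y))_H$; that is, $V$ is a Hilbert space and $q\colon\operatorname{dom}(a)\to V$ is linear with dense range and $(x\mid y)_{a,j}=(q(x)\mid q(y))_V$. Let $\tilde\jmath\colon V\to H$ and $\tilde a\colon V\times V\to\mathbb{C}$ be the unique continuous linear operator and unique continuous sesquilinear form with $\tilde\jmath\circ q=j$ and $\tilde a(q(x),q(y))=a(x,y)$. The linear relation associated with $(a,j)$ is $$A:=\{(x,y)\in H\times H;\ \exists\,u\in V:\ \tilde\jmath(u)=x,\ \tilde a(u,v)=(y\mid\tilde\jmath(v))_H\ \text{for all } v\in V\}.$$ If $(a,j)$ is quasi-sectorial with vertex $\gamma$, put $a_{-\gamma}(x,y):=a(x,y)-\gamma(j(x)\mid j(y))_H$, let $A_{-\gamma}$ be the linear relation associated with the sectorial form $(a_{-\gamma},j)$, and define the linear relation associated with $(a,j)$ by $A:=\{(x,y+\gamma x);\ (x,y)\in A_{-\gamma}\}$; this does not depend on the choice of the vertex $\gamma$. One has $A=A_1\oplus(\{0\}\times H_0)$, where $H_1:=\overline{\operatorname{ran}(j)}$, $H_0:=H_1^\perp$,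 and $A_1$ is a quasi-m-sectorial operator in $H_1$, so that $-A_1$ generates a $C_0$-semigroup on $H_1$. In the claim, the hypothesis on $a_n-a$ implies that each $(a_n,j|_{\operatorname{dom}(a_n)})$ is quasi-sectorial with the same vertex as $(a,j)$, so $A_n$ is defined. **Degenerate strongly continuous semigroups.** Let $X$ be a Banach space. A one-parameter semigroup $T\colon[0,\infty)\to\mathcal{L}(X)$ (i.e. $T(t+s)=T(t)T(s)$ for all $s,t\ge0$; then $P:=T(0)$ is a projection, not necessarily the identity) is a degenerate strongly continuous semigroup if $T(t)x\to T(0)x$ as $t\to0+$ for all $x\in X$. Such a $T$ is the direct sum of a $C_0$-semigroup $T_1$ on $X_1:=P(X)$ (the restriction of $T$ to $X_1$) and the zero semigroup on $X_0:=(I-P)(X)$. If $B_1$ is the generator of $T_1$, then the generator of $T$ is the linear relation $\{(x,B_1x+y);\ x\in\operatorname{dom}(B_1),\ y\in X_0\}$. For the linear relation $A=A_1\oplus(\{0\}\times H_0)$ above, $-A:=\{(x,-y);\ (x,y)\in A\}$ is thus the generator of the degenerate strongly continuous semigroup on $H$ that is the direct sum of the $C_0$-semigroup on $H_1$ generated by $-A_1$ and the zero semigroup on $H_0$; analogously for each $A_n$, with $j|_{\operatorname{dom}(a_n)}$ in place of $j$. *)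

(* Defs.v *)
From HB Require Import structures.
From mathcomp Require Import all_boot all_order all_algebra.
From mathcomp Require Import sesquilinear complex ring.
From mathcomp Require Import all_classical all_reals all_analysis.

Set Implicit Arguments.
Unset Strict Implicit.
Unset Printing Implicit Defensive.

Import Order.TTheory GRing.Theory Num.Theory.
Import numFieldNormedType.Exports.

Local Open Scope classical_set_scope.
Local Open Scope ring_scope.
Local Open Scope complex_scope.

(* The field R[i] gets the topology of its norm, as every numFieldType does;
   the generic instance is not found through the head constant [complex]. *)
HB.instance Definition _ (R : realType) :=
  NormedModule.copy R[i] [the numFieldType of R[i]]^o.

HB.mixin Record CompleteNormedModule_isHilbert (R : realType) H
    & CompleteNormedModule R[i] H := {
  hdot : H -> H -> R[i] ;
  hdot_linear_l : forall y : H, linear_for *%R (hdot^~ y) ;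
  hdot_conj : forall x y : H, hdot x y = (hdot y x)^*%R ;
  hdot_norm : forall x : H, hdot x x = `|x| ^+ 2
}.

#[short(type="hilbertType")]
HB.structure Definition Hilbert (R : realType) :=
  {H of CompleteNormedModule_isHilbert R H & CompleteNormedModule R[i] H}.

Section HilbertDot.
Variables (R : realType) (H : hilbertType R).

Let hdot_linear_r (x : H) :
  linear_for (Num.conj \; *%R) (@hdot R H x).
Proof.
move=> c y z; rewrite hdot_conj hdot_linear_l rmorphD rmorphM /=.
by rewrite -!hdot_conj.
Qed.

HB.instance Definition _ := bilinear_isBilinear.Build R[i] H H R[i]
  *%R (Num.conj \; *%R) (@hdot R H) (@hdot_linear_l R H, hdot_linear_r).

Let hdot_herm (x y : H) : hdot x y = (-1) ^+ false * (hdot y x)^*%R.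
Proof. by rewrite expr0 mul1r hdot_conj. Qed.

HB.instance Definition _ :=
  isHermitianSesquilinear.Build R[i] H false Num.conj (@hdot R H) hdot_herm.

Let hdot_gt0 (x : H) : x != 0 -> 0 < hdot x x.
Proof. by move=> x0; rewrite hdot_norm exprn_gt0 ?normr_gt0. Qed.

HB.instance Definition _ := isDotProduct.Build R[i] H (@hdot R H) hdot_gt0.

End HilbertDot.

Notation "{ 'sesqui' E }" :=
  {bilinear E -> E -> _ | *%R & Num.conj \; *%R}
  (format "{ 'sesqui'  E }") : type_scope.

Section Forms.
Variable R : realType.
Local Notation C := R[i].

Definition sector (theta : R) : set C :=
  [set z | exists r alpha : R,
    [/\ 0 < r, (- theta < alpha < theta) \/ alpha = 0 &
        z = r%:C * (cos alpha +i* sin alpha)]].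

Section FormsInHilbertSpace.
Variables (H : hilbertType R) (E : lmodType C).
Implicit Types (a : E -> E -> C) (j : E -> H).

Definition quasi_sectorial (theta gamma : R) a j : Prop :=
  forall u, closure (sector theta) (a u u - gamma%:C * `|j u| ^+ 2).

Definition real_part_form a (x y : E) : C := (a x y + (a y x)^*%R) / 2.

Definition shift_form (gamma : R) a j (x y : E) : C :=
  a x y - gamma%:C * hdot (j x) (j y).

Definition semi_inner a j (x y : E) : C :=
  real_part_form a x y + hdot (j x) (j y).

Lemma semi_inner_shift (gamma : R) a j x y :
  semi_inner (shift_form gamma a j) j x y =
  real_part_form a x y + (1 - gamma)%:C * hdot (j x) (j y).
Proof.
have gammaR : (gamma%:C)^*%R = gamma%:C :> C.
  by apply/conj_Creal/complex_realP; exists gamma.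
rewrite /semi_inner /real_part_form /shift_form rmorphB rmorphM /=.
rewrite -hdot_conj.
rewrite gammaR [X in _ = _ + X * _]rmorphB rmorph1.
by field.
Qed.

(* The semi-inner product takes nonnegative real values on the diagonal when
   gamma is a vertex of (a, j). *)
Definition form_seminorm (gamma : R) a j (x : E) : R :=
  Num.sqrt (complex.Re (semi_inner (shift_form gamma a j) j x x)).

Definition form_cvg (gamma : R) a j (u_ : nat -> E) (u : E) : Prop :=
  form_seminorm gamma a j (u_ n - u) @[n --> \oo] --> (0 : R).

Definition is_core (gamma : R) a j (D : {pred E}) : Prop :=
  submod_closed D /\
  forall u (e : R), 0 < e ->
    exists2 v, v \in D & form_seminorm gamma a j (u - v) < e.

Definition is_completion a j (V : hilbertType R) (q : {linear E -> V}) : Prop :=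
  dense (range q) /\
  forall x y, hdot (q x) (q y) = semi_inner a j x y.

(* Completions, and the extensions of j and a to them, are unique up to unitary
   equivalence; hence at most one A satisfies this predicate. *)
Definition associated_sectorial a j (A : set (H * H)) : Prop :=
  exists (V : hilbertType R) (q : {linear E -> V})
         (jt : {linear V -> H}) (at_ : {sesqui V}),
  [/\ is_completion a j q,
      continuous jt /\ (forall x, jt (q x) = j x),
      continuous (fun p : V * V => at_ p.1 p.2) /\
        (forall x y, at_ (q x) (q y) = a x y) &
      A = [set xy | exists u : V,
             jt u = xy.1 /\ forall v, at_ u v = hdot xy.2 (jt v)]].

Definition associated (gamma : R) a j (A : set (H * H)) : Prop :=
  exists2 B, associated_sectorial (shift_form gamma a j) j B &
    A = [set (p.1, p.2 + gamma%:C *: p.1) | p in B].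

End FormsInHilbertSpace.

Definition opp_relation (H : lmodType C) (A : set (H * H)) : set (H * H) :=
  [set (p.1, - p.2) | p in A].

Section Semigroups.
Variable X : completeNormedModType C.

(* Only the values T t with 0 <= t are meaningful. *)
Implicit Types T : R -> {linear X -> X}.

Definition degenerate_semigroup T : Prop :=
  [/\ forall t, 0 <= t -> continuous (T t),
      forall s t x, 0 <= s -> 0 <= t -> T (t + s) x = T t (T s x) &
      forall x, T t x @[t --> 0^'+] --> T 0 x].

(* The graph of the generator of the restriction of T to the range of T 0; the
   limit is automatically in that range, which is closed. *)
Definition regular_generator T : set (X * X) :=
  [set xb | range (T 0) xb.1 /\
     (t^-1)%:C *: (T t xb.1 - xb.1) @[t --> 0^'+] --> xb.2].

Definition generator T : set (X * X) :=
  [set p | exists b y, [/\ regular_generator T (p.1, b),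
     range (fun z => z - T 0 z) y & p.2 = b + y]].

End Semigroups.
End Forms.

(* Main.v *)
Require Import Defs.
From HB Require Import structures.
From mathcomp Require Import all_boot all_order all_algebra.
From mathcomp Require Import sesquilinear complex ring lra.
From mathcomp Require Import all_classical all_reals all_analysis.
Set Implicit Arguments.
Unset Strict Implicit.
Unset Printing Implicit Defensive.
Import Order.TTheory GRing.Theory Num.Theory.
Import numFieldNormedType.Exports.
Local Open Scope classical_set_scope.
Local Open Scope ring_scope.

(** The proof goes through resolvents. Write [b = a - gamma (j | j)], a form with
values in a closed sector, and let [B] be the relation associated with it, so
that [A = B + gamma]. On the completion [V] of the form domain the sesquilinear
form [b + (j | j)] has the squared norm of [V] as its real part. The Lax-Milgram
theorem therefore solves [b(u, v) + (j u | j v) = (y | j v)] for every [y], and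
[y |-> j u] is the everywhere defined resolvent [Q = (1 + B)^-1]
([exists_resolvent]). In the same way [a_n] gives [b_n], [B_n] and [Q_n].

_Convergence of the resolvents._ The difference [d_n = a_n - a] is sectorial, so
[Re b_n >= Re b], and both [d_n] and [b + (j | j)] satisfy a Cauchy-Schwarz
inequality with a constant that does not depend on [n] ([sesqui_young]). Let [u]
and [z_n] solve the two variational problems and let [w_n] be admissible with
[w_n -> u] and [d_n(w_n) -> 0]. Testing both problems with [z_n - w_n] bounds the
energy of [z_n - w_n] by that of [u - w_n] and by [d_n(w_n)]
([galerkin_estimate]); hence [Q_n y -> Q y] ([resolvent_cvg]). The completion of
the domain of [a_n] never has to be compared with [V]: elements of the original
domains that solve the variational problems up to a small error suffice.

_From resolvents to semigroups._ Multiplication by [e^{gamma t}] turns [T] and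
[T_n] into semigroups [S] and [S_n] generated by [-B] and [-B_n]. As [B] is
accretive, these consist of contractions ([dissipative_contraction]). For fixed
[y] and [t] the curve [s |-> S_n(t - s) Q_n S(s) Q y] joins [S_n(t) Q_n Q y] to
[Q_n S(t) Q y], and the norm of its right derivative is at most
[|(Q - Q_n) S(s) y|]. This is uniformly small, because the orbit of [y] over a
compact time interval is compact and the [Q_n] are contractions that converge
strongly. A mean value inequality for one-sided derivatives then gives the
convergence on the range of [Q^2], hence on the range of [S(0)]
([trotter_kato]).

_Degeneracy._ The kernel of [S(0)] is the orthogonal complement of the range of
[j], which is contained in the corresponding complement for [a_n]; all the
semigroups vanish there. A vector orthogonal to the range of [Q] is annihilated
by [S(0)], so that the projection theorem makes the range of [Q] dense in the
range of [S(0)] ([range_projection]). Together these two facts settle every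
vector of [H]. *)

(** * The real-valued norm of a complex normed module *)

Section RealNorm.
Variable R : realType.
Local Notation C := R[i].
Local Open Scope complex_scope.

(** Norms over the complex field take values in that field, which is only
partially ordered. All estimates below are made in the totally ordered field of
real numbers. *)
Definition rnorm (V : normedModType C) (x : V) : R := complex.Re `|x|.

Lemma rnormE (V : normedModType C) (x : V) : `|x| = (rnorm x)%:C.
Proof. by rewrite /rnorm RRe_real // ger0_real. Qed.

Lemma posC_real (e : C) : 0 < e -> exists2 r : R, 0 < r & e = r%:C.
Proof.
move=> e0; have /complex_realP[r er] : e \is Num.real by exact: gtr0_real.
by exists r => //; move: e0; rewrite er ltcR.
Qed.

Section Theory.
Variable V : normedModType C.
Implicit Types x y : V.

Lemma rnorm_ge0 x : 0 <= rnorm x.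
Proof. by rewrite -lecR -rnormE normr_ge0. Qed.

Lemma rnormD x y : rnorm (x + y) <= rnorm x + rnorm y.
Proof. by rewrite -lecR raddfD /= -!rnormE ler_normD. Qed.

Lemma rnormN x : rnorm (- x) = rnorm x.
Proof. by rewrite /rnorm normrN. Qed.

Lemma rnormBC x y : rnorm (x - y) = rnorm (y - x).
Proof. by rewrite -rnormN opprB. Qed.

Lemma rnormB x y : rnorm (x - y) <= rnorm x + rnorm y.
Proof. by rewrite -[rnorm y]rnormN rnormD. Qed.

Lemma rnorm_triangle y x z : rnorm (x - z) <= rnorm (x - y) + rnorm (y - z).
Proof. by rewrite (le_trans _ (rnormD _ _))// addrA subrK. Qed.

Lemma rnorm0 : rnorm (0 : V) = 0.
Proof. by rewrite /rnorm normr0. Qed.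

Lemma rnorm0_eq0 x : rnorm x = 0 -> x = 0.
Proof. by move=> x0; apply/normr0_eq0; rewrite rnormE x0. Qed.

Lemma rnormZ (c : C) x : rnorm (c *: x) = rnorm c * rnorm x.
Proof. by rewrite {1}/rnorm normrZ !rnormE -rmorphM. Qed.

Lemma rnormZr (r : R) x : 0 <= r -> rnorm (r%:C *: x) = r * rnorm x.
Proof. by move=> r0; rewrite rnormZ {1}/rnorm ger0_norm // lecR. Qed.

Lemma rnorm_le_eps x : (forall e, 0 < e -> rnorm x < e) -> x = 0.
Proof.
move=> xe; apply/rnorm0_eq0/eqP; rewrite eq_le rnorm_ge0 andbT leNgt.
by apply/negP => /xe; rewrite ltxx.
Qed.

Lemma cvg_rnormP (T : Type) (G : set_system T) (FG : Filter G) (f : T -> V) (l : V) :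
  f @ G --> l <-> forall e : R, 0 < e -> \forall t \near G, rnorm (l - f t) < e.
Proof.
split=> [/cvgrPdist_lt fl e e0|fl].
  have := fl e%:C; rewrite ltcR => /(_ e0); apply: filterS => t /=.
  by rewrite rnormE ltcR.
apply/cvgrPdist_lt => e /posC_real[r r0 ->]; apply: filterS (fl r r0) => t.
by rewrite rnormE ltcR.
Qed.

Lemma nbhs_rnormP x (P : V -> Prop) :
  (\near x, P x) <->
  exists2 e : R, 0 < e & forall y, rnorm (x - y) < e -> P y.
Proof.
split=> [/nbhs_normP[e /= /posC_real[r r0 ->] xP]|[e e0 xP]].
  by exists r => // y yr; apply: xP; rewrite /= rnormE ltcR.
apply/nbhs_normP; exists e%:C; rewrite /= ?ltcR// => y /=.
by rewrite rnormE ltcR; exact: xP.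
Qed.

Lemma closure_rnormP (A : set V) x :
  closure A x <-> forall e : R, 0 < e -> exists2 y, A y & rnorm (x - y) < e.
Proof.
split=> [xA e e0|xA B /nbhs_rnormP[e e0 eB]].
  have [|y [Ay xy]] := xA [set y | rnorm (x - y) < e]; last by exists y.
  by apply/nbhs_rnormP; exists e.
by have [y Ay xy] := xA e e0; exists y; split => //; exact: eB.
Qed.

End Theory.

Lemma continuous_rnormP (V W : normedModType C) (f : V -> W) x :
  {for x, continuous f} <-> forall e : R, 0 < e -> exists2 d : R, 0 < d &
    forall y, rnorm (x - y) < d -> rnorm (f x - f y) < e.
Proof.
split=> [/cvg_rnormP fx e /fx/nbhs_rnormP//|fx].
by apply/cvg_rnormP => e /fx ?; apply/nbhs_rnormP.
Qed.

Lemma rnorm_cauchy (V : completeNormedModType C) (u : nat -> V) :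
  (forall e : R, 0 < e -> exists N, forall n m, (N <= n)%N -> (N <= m)%N ->
     rnorm (u n - u m) < e) ->
  exists l, forall e : R, 0 < e -> \forall n \near \oo, rnorm (l - u n) < e.
Proof.
move=> cu; have : cvg (u @ \oo).
  apply/cauchy_cvgP/cauchy_exP => e /posC_real[r r0 ->].
  have [N uN] := cu _ r0; exists (u N); exists N => // n /= Nn.
  by rewrite -ball_normE /= rnormE ltcR uN.
by move=> cvu; exists (lim (u @ \oo)); apply/cvg_rnormP.
Qed.

End RealNorm.

(** * Real and imaginary parts, and closed sectors *)

Section ComplexParts.
Variable R : realType.
Local Notation C := R[i].
Local Open Scope complex_scope.
Implicit Types z w : C.

Lemma ReD z w : complex.Re (z + w) = complex.Re z + complex.Re w.
Proof. by case: z; case: w. Qed.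

Lemma ReN z : complex.Re (- z) = - complex.Re z.
Proof. by case: z. Qed.

Lemma ReB z w : complex.Re (z - w) = complex.Re z - complex.Re w.
Proof. by rewrite ReD ReN. Qed.

Lemma ImB z w : complex.Im (z - w) = complex.Im z - complex.Im w.
Proof. by case: z; case: w. Qed.

Lemma ReZ (r : R) z : complex.Re (r%:C * z) = r * complex.Re z.
Proof. by case: z => x y; simpc. Qed.

Lemma ReJ z : complex.Re (z^*)%R = complex.Re z.
Proof. by case: z. Qed.

Lemma conj_real (r : R) : ((r%:C)^*)%R = r%:C :> C.
Proof. by apply/conj_Creal/complex_realP; exists r. Qed.

Lemma rnormC z : rnorm (z : C) = ComplexField.Normc.normc z.
Proof. by []. Qed.

Lemma rnormM z w : rnorm (z * w : C) = rnorm z * rnorm w.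
Proof. exact: (rnormZ z (w : C)). Qed.

Lemma Re_le_rnorm z : `|complex.Re z| <= rnorm z.
Proof. by rewrite -lecR -rnormE; exact: normc_ge_Re. Qed.

Lemma Im_le_rnorm z : `|complex.Im z| <= rnorm z.
Proof.
case: z => x y; rewrite rnormC /= -[`|y|]sqrtr_sqr ler_sqrt ?addr_ge0 ?sqr_ge0//.
by rewrite lerDr sqr_ge0.
Qed.

Lemma rnorm_le_ReIm z : rnorm z <= `|complex.Re z| + `|complex.Im z|.
Proof.
case: z => x y; rewrite rnormC /=.
rewrite -[leRHS](@ger0_norm _ (`|x| + `|y|)) ?addr_ge0// -sqrtr_sqr.
rewrite ler_sqrt ?sqr_ge0// sqrrD !real_normK ?num_real//.
by rewrite -addrA lerD2l lerDr mulrn_wge0 // mulr_ge0.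
Qed.

Lemma rnorm_real (r : R) : rnorm (r%:C : C) = `|r|.
Proof. by rewrite rnormC /= expr0n addr0 sqrtr_sqr. Qed.

Lemma tan_ge0 (theta : R) : 0 <= theta < pi / 2 -> 0 <= tan theta.
Proof.
move=> /andP[t0 tpi]; rewrite /tan divr_ge0//.
  by apply: sin_ge0_pi; rewrite t0/=; have := pi_gt0 R; lra.
apply/ltW/cos_gt0_pihalf; rewrite tpi andbT.
by rewrite (lt_le_trans _ t0)// oppr_lt0 divr_gt0 ?pi_gt0.
Qed.

(** For [z = r e^{i alpha}] in the open sector, [|Im z| <= tan theta Re z] says
that [sin |alpha| cos theta <= sin theta cos |alpha|], that is
[sin (theta - |alpha|) >= 0]. Both inequalities survive passing to limits. *)
Lemma closed_sector_bound (theta : R) z : 0 <= theta < pi / 2 ->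
  closure (sector theta) z ->
  0 <= complex.Re z /\ `|complex.Im z| <= tan theta * complex.Re z.
Proof.
move=> /andP[t0 tpi] zs.
have cos0 : 0 < cos theta.
  by rewrite cos_gt0_pihalf // tpi andbT (lt_le_trans _ t0)// oppr_lt0 divr_gt0 ?pi_gt0.
have tan0 : 0 <= tan theta by apply: tan_ge0; rewrite t0.
have dense_sector := iffLR (closure_rnormP (sector theta : set C) z) zs.
have sectorP w : sector theta w ->
    0 <= complex.Re w /\ `|complex.Im w| <= tan theta * complex.Re w.
  move=> [r [al [r0 hal ->]]].
  have al_lt : `|al| <= theta.
    by case: hal => [/andP[h1 h2]|->]; rewrite ?normr0// ler_norml !ltW.
  have -> : complex.Re (r%:C * (cos al +i* sin al)) = r * cos `|al|.
    by rewrite ReZ/=; case: (ler0P al); rewrite ?cosN.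
  have -> : `|complex.Im (r%:C * (cos al +i* sin al))| = r * sin `|al|.
    simpc; rewrite /= normrM gtr0_norm//; congr (_ * _).
    have spos b : 0 <= b <= theta -> 0 <= sin b.
      move=> /andP[b0 bt]; apply: sin_ge0_pi; rewrite b0/=.
      by have := pi_gt0 R; lra.
    have [al0|al0] := lerP 0 al.
      by rewrite !ger0_norm ?spos// -(ger0_norm al0)// normr_ge0.
    rewrite (ltr0_norm al0) -normrN -sinN ger0_norm// spos//.
    by rewrite oppr_ge0 ltW//= -ltr0_norm.
  have ca : 0 <= cos `|al|.
    apply/ltW/cos_gt0_pihalf; rewrite (le_lt_trans al_lt)// andbT.
    by rewrite (lt_le_trans _ (normr_ge0 _))// oppr_lt0 divr_gt0 ?pi_gt0.
  split; first by rewrite mulr_ge0// ltW.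
  rewrite mulrCA ler_pM2l// /tan -mulrAC ler_pdivlMr//.
  rewrite -subr_ge0 [X in _ - X]mulrC -sinB sin_ge0_pi// subr_ge0 al_lt/=.
  by have := pi_gt0 R; have := normr_ge0 al; lra.
split.
  rewrite leNgt; apply/negP => z0.
  have [|w /sectorP[w0 _]] := dense_sector (- complex.Re z); first by rewrite oppr_gt0.
  by have := Re_le_rnorm (z - w); rewrite ReB ler_norml; lra.
rewrite leNgt; apply/negP => zI.
set d := `|complex.Im z| - tan theta * complex.Re z.
have d0 : 0 < d by rewrite subr_gt0.
have [|w /sectorP[w0 w1] zw] := dense_sector (d / (1 + tan theta)).
  by rewrite divr_gt0// ltr_pwDl.
have h1 := Re_le_rnorm (z - w); have h2 := Im_le_rnorm (z - w).
rewrite ReB in h1; rewrite ImB in h2.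
have h3 := lerB_dist (complex.Im z) (complex.Im w).
have h4 : complex.Re w - complex.Re z <= rnorm (z - w : C).
  by move: h1; rewrite ler_norml; lra.
have h5 := ler_wpM2l tan0 h4.
have tan1 : 0 < 1 + tan theta by rewrite ltr_pwDl.
by move: zw; rewrite ltr_pdivlMr// /d; lra.
Qed.

End ComplexParts.

(** * Sesquilinear forms and Hilbert space geometry *)

Section Sesqui.
Variable R : realType.
Local Notation C := R[i].
Local Open Scope complex_scope.

(** The identity that recovers a form from its diagonal; over the complex
numbers it needs no symmetry. *)
Lemma sesqui_polarization (E : lmodType C) (s : {sesqui E}) u v :
  4%:R * s u v = s (u + v) (u + v) - s (u - v) (u - v) +
    'i%R * s (u + 'i%R *: v) (u + 'i%R *: v) -
    'i%R * s (u - 'i%R *: v) (u - 'i%R *: v).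
Proof.
have expand w : s (u + w) (u + w) = s u u + s u w + s w u + s w w.
  by rewrite linearDl !linearDr /= addrA.
rewrite !expand !(linearNr, linearNl) /= !(linearZl_LR, linearZr_LR) /= conjCi.
have i2 : 'i%R * 'i%R = -1 :> C by rewrite -expr2 sqrCi.
move: (s u u) (s u v) (s v u) (s v v) => p q r t.
transitivity (2 * q + 2 * r + 'i%R * 'i%R * (2 * r - 2 * q)); last by ring.
by rewrite i2; ring.
Qed.

Section Sectorial.
Variables (E : lmodType C) (s : {sesqui E}) (c : R).
Hypothesis s_ge0 : forall u, 0 <= complex.Re (s u u).
Hypothesis s_sect : forall u, `|complex.Im (s u u)| <= c * complex.Re (s u u).

Let rnorm_diag u : rnorm (s u u) <= (1 + c) * complex.Re (s u u).
Proof.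
rewrite (le_trans (rnorm_le_ReIm _))// (ger0_norm (s_ge0 u)) mulrDl mul1r.
by rewrite lerD2l.
Qed.

Let rnormi : rnorm ('i%R : C) = 1.
Proof. by rewrite /rnorm normCi. Qed.

Let sesqui_young1 u v :
  rnorm (s u v) <= (1 + c) * (complex.Re (s u u) + complex.Re (s v v)).
Proof.
rewrite -(@ler_pM2l _ 4)// -[X in X * rnorm _](@ger0_norm _ 4)//.
rewrite -rnorm_real -rnormM.
rewrite (_ : (4 : R)%:C = 4%:R); last exact: rmorph_nat.
rewrite sesqui_polarization.
have -> : 4 * ((1 + c) * (complex.Re (s u u) + complex.Re (s v v))) =
   (1 + c) * complex.Re (s (u + v) (u + v)) +
   (1 + c) * complex.Re (s (u - v) (u - v)) +
   (1 + c) * complex.Re (s (u + 'i%R *: v) (u + 'i%R *: v)) +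
   (1 + c) * complex.Re (s (u - 'i%R *: v) (u - 'i%R *: v)).
  have par w : complex.Re (s (u + w) (u + w)) + complex.Re (s (u - w) (u - w))
      = 2 * complex.Re (s u u) + 2 * complex.Re (s w w).
    rewrite !(linearDl, linearNl) /= !(linearDr, linearNr) /= !(ReD, ReN); ring.
  rewrite -!mulrDr -addrA par par.
  have -> : s ('i%R *: v) ('i%R *: v) = s v v.
    rewrite linearZl_LR linearZr_LR /= conjCi mulNr mulrN mulrA -expr2 sqrCi.
    by rewrite mulN1r opprK.
  ring.
do 2![apply: (le_trans (rnormB _ _)) || apply: (le_trans (rnormD _ _));
  apply: lerD; last by rewrite rnormM rnormi mul1r].
by apply: (le_trans (rnormB _ _)); apply: lerD.
Qed.

(** A Cauchy-Schwarz inequality for a form that is sectorial but not symmetric, in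
the form without square roots: minimising over [t] would give
[2 (1 + c) sqrt (Re s(u, u)) sqrt (Re s(v, v))]. Polarization and the
parallelogram law give the case [t = 1]; replacing [u] and [v] by
[sqrt t u] and [v / sqrt t] does not change the left-hand side. *)
Lemma sesqui_young u v t : 0 < t ->
  rnorm (s u v) <=
    (1 + c) * (t * complex.Re (s u u) + t^-1 * complex.Re (s v v)).
Proof.
move=> t0; pose r := Num.sqrt t; have r0 : 0 < r by rewrite sqrtr_gt0.
have r2 : r * r = t by rewrite -expr2 sqr_sqrtr// ltW.
have sZ (k l : R) x y : s (k%:C *: x) (l%:C *: y) = (k * l)%:C * s x y.
  by rewrite linearZl_LR linearZr_LR /= conj_real mulrA -rmorphM.
have := sesqui_young1 (r%:C *: u) (r^-1%:C *: v).
rewrite !sZ !ReZ divff ?gt_eqF// mul1r r2 -invfM r2.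
done.
Qed.

End Sectorial.
End Sesqui.

Section HilbertGeometry.
Variables (R : realType) (H : hilbertType R).
Local Notation C := R[i].
Local Open Scope complex_scope.
Implicit Types x y z : H.

Lemma hdotDl x y z : hdot (x + y) z = hdot x z + hdot y z.
Proof. exact: linearDl. Qed.

Lemma hdotDr x y z : hdot x (y + z) = hdot x y + hdot x z.
Proof. exact: linearDr. Qed.

Lemma hdotBl x y z : hdot (x - y) z = hdot x z - hdot y z.
Proof. exact: linearBl. Qed.

Lemma hdotBr x y z : hdot x (y - z) = hdot x y - hdot x z.
Proof. exact: linearBr. Qed.

Lemma hdotZl c x y : hdot (c *: x) y = c * hdot x y.
Proof. exact: linearZl_LR. Qed.

Lemma hdotZr c x y : hdot x (c *: y) = (c^*)%R * hdot x y.
Proof. exact: linearZr_LR. Qed.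

Lemma hdot0l x : hdot 0 x = 0.
Proof. exact: linear0l. Qed.

Lemma hdot0r x : hdot x 0 = 0.
Proof. exact: linear0r. Qed.

Lemma hdot_rnorm x : hdot x x = (rnorm x ^+ 2)%:C.
Proof. by rewrite hdot_norm rnormE rmorphXn. Qed.

Lemma Re_hdot x : complex.Re (hdot x x) = rnorm x ^+ 2.
Proof. by rewrite hdot_rnorm. Qed.

Lemma Re_hdotC x y : complex.Re (hdot x y) = complex.Re (hdot y x).
Proof. by rewrite hdot_conj ReJ. Qed.

Lemma rnormD2 x y :
  rnorm (x + y) ^+ 2 = rnorm x ^+ 2 + rnorm y ^+ 2 + 2 * complex.Re (hdot x y).
Proof.
rewrite -!Re_hdot linearDl !linearDr /= !ReD (Re_hdotC y x); ring.
Qed.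

Lemma rnormB2 x y :
  rnorm (x - y) ^+ 2 = rnorm x ^+ 2 + rnorm y ^+ 2 - 2 * complex.Re (hdot x y).
Proof. by rewrite rnormD2 rnormN linearNr ReN mulrN. Qed.

(** Subtracting a multiple of the vector [(x | y) y] gives a quadratic polynomial in
the real factor [t]. The value [t = 1 / |y|^2] yields the Cauchy-Schwarz
inequality, and a small [t] shows that a nearest point of a subspace is an
orthogonal projection. *)
Lemma rnorm_sub_dot x y (t : R) :
  rnorm (x - (t%:C * hdot x y) *: y) ^+ 2 = rnorm x ^+ 2
    - 2 * t * rnorm (hdot x y) ^+ 2 + t ^+ 2 * rnorm (hdot x y) ^+ 2 * rnorm y ^+ 2.
Proof.
have h : complex.Re (hdot x y * (hdot x y)^*%R) = rnorm (hdot x y) ^+ 2.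
  by rewrite -normCK rnormE -rmorphXn.
have tJ : ((t%:C * hdot x y)^*)%R = t%:C * (hdot x y)^*%R.
  by rewrite rmorphM /= conj_real.
rewrite rnormB2 rnormZ rnormM rnorm_real linearZr_LR /= tJ.
rewrite -(mulrA t%:C) [X in t%:C * X]mulrC ReZ h !exprMn real_normK ?num_real//; ring.
Qed.

Lemma cauchy_schwarz x y : rnorm (hdot x y) <= rnorm x * rnorm y.
Proof.
have [y0|y0] := eqVneq (rnorm y) 0.
  by rewrite (rnorm0_eq0 y0) linear0r !rnorm0 mulr0.
have yp : 0 < rnorm y by rewrite lt_def y0 rnorm_ge0.
rewrite -(@ler_pXn2r _ 2)// ?nnegrE ?mulr_ge0 ?rnorm_ge0//.
have := sqr_ge0 (rnorm (x - ((rnorm y ^- 2)%:C * hdot x y) *: y)).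
rewrite rnorm_sub_dot exprMn.
have -> : rnorm x ^+ 2 - 2 * rnorm y ^- 2 * rnorm (hdot x y) ^+ 2
   + (rnorm y ^- 2) ^+ 2 * rnorm (hdot x y) ^+ 2 * rnorm y ^+ 2 =
   rnorm x ^+ 2 - rnorm (hdot x y) ^+ 2 / rnorm y ^+ 2 by field.
by rewrite subr_ge0 ler_pdivrMr ?exprn_gt0.
Qed.

Definition subspace (M : set H) :=
  [/\ M 0, forall x y, M x -> M y -> M (x + y) & forall c x, M x -> M (c *: x)].

(** By the parallelogram law a minimising sequence for the distance from [x] to [M]
is a Cauchy sequence; its limit is the nearest point of [M]. *)
Lemma projection_theorem (M : set H) : subspace M -> closed M ->
  forall x, exists2 m, M m & forall z, M z -> hdot (x - m) z = 0.
Proof.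
move=> [M0 MD MZ] cM x.
pose S := [set rnorm (x - m) ^+ 2 | m in M].
have Sinf : has_inf S.
  split; first by exists (rnorm (x - 0) ^+ 2), 0.
  by exists 0 => _ [m _ <-]; exact: sqr_ge0.
pose d := inf S.
have dle m : M m -> d <= rnorm (x - m) ^+ 2.
  by move=> Mm; apply: ge_inf; [case: Sinf|exists m].
have /choice[u uP] : forall n : nat, exists m, M m /\
    rnorm (x - m) ^+ 2 < d + n.+1%:R^-1.
  move=> n; have [|_ [m Mm <-] mlt] := @inf_adherent _ S n.+1%:R^-1 _ Sinf.
    by rewrite invr_gt0.
  by exists m.
have par n k : rnorm (u n - u k) ^+ 2 <= 2 * n.+1%:R^-1 + 2 * k.+1%:R^-1.
  have [Mn nlt] := uP n; have [Mk klt] := uP k.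
  have := rnormB2 (x - u n) (x - u k); have := rnormD2 (x - u n) (x - u k).
  have -> : x - u n - (x - u k) = u k - u n.
    by rewrite opprB addrC addrA subrK.
  rewrite (rnormBC (u n) (u k)).
  have -> : x - u n + (x - u k) = 2%:R%:C *: (x - (2%:R^-1)%:C *: (u n + u k)).
    rewrite scalerBr scalerA -rmorphM divff// scale1r rmorph_nat scaler_nat.
    by rewrite mulr2n opprD addrACA.
  rewrite rnormZr// exprMn.
  have := dle _ (MZ (2%:R^-1)%:C _ (MD _ _ Mn Mk)).
  move: nlt klt; move: (n.+1%:R^-1) (k.+1%:R^-1) => e1 e2; lra.
have [|m um] := @rnorm_cauchy _ _ u.
  move=> e e0; have := @near_infty_natSinv_lt R (PosNum (divr_gt0 (exprn_gt0 2 e0) (ltr0n R 4))).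
  move=> [N _ Nlt]; exists N => n k Nn Nk.
  rewrite -(@ltr_pXn2r _ 2)// ?nnegrE ?rnorm_ge0 ?ltW//.
  apply: (le_lt_trans (par n k)); have := Nlt n Nn; have := Nlt k Nk => /=.
  move: (n.+1%:R^-1) (k.+1%:R^-1) => e1 e2; lra.
have Mm : M m.
  apply: cM => B /nbhs_rnormP[e e0 eB].
  have [N _ Nlt] := um e e0; exists (u N); split; first by have [] := uP N.
  by apply: eB; apply: Nlt => /=.
have md : rnorm (x - m) ^+ 2 <= d.
  have d0 : 0 <= d by apply: lb_le_inf; [case: Sinf|move=> _ [k _ <-]; exact: sqr_ge0].
  rewrite leNgt; apply/negP => dlt.
  pose q := rnorm (x - m); pose r := Num.sqrt d.
  have r2 : r ^+ 2 = d by rewrite sqr_sqrtr.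
  have rq : r < q.
    by rewrite -(@ltr_pXn2r _ 2)// ?nnegrE ?sqrtr_ge0 ?rnorm_ge0// r2.
  have e0 : 0 < (q - r) / 2 by rewrite divr_gt0// subr_gt0.
  have [N1 _ h1] := um _ e0.
  have [N2 _ h2] := @near_infty_natSinv_lt R (PosNum (exprn_gt0 2 e0)).
  pose n := maxn N1 N2.
  have := h1 n (leq_maxl _ _); have /= := h2 n (leq_maxr _ _).
  have [_ un] := uP n => h3; rewrite rnormBC => h4.
  move: un h3; move: (n.+1%:R^-1) => e1 un h3.
  have : rnorm (x - u n) < r + (q - r) / 2.
    rewrite -(@ltr_pXn2r _ 2)// ?nnegrE ?rnorm_ge0// ?addr_ge0 ?sqrtr_ge0 ?ltW//.
    apply: (lt_trans un); rewrite sqrrD r2 -mulr_natr.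
    have := mulr_ge0 (sqrtr_ge0 d) (ltW e0); rewrite -/r; lra.
  have := rnorm_triangle (u n) x m; rewrite -/q; lra.
exists m => // z Mz; apply/rnorm0_eq0/eqP.
apply/negPn/negP => z0.
have zp : 0 < rnorm (hdot (x - m) z) ^+ 2.
  by rewrite exprn_gt0// lt_def z0 rnorm_ge0.
pose t := (1 + rnorm z ^+ 2)^-1.
have t0 : 0 < t by rewrite invr_gt0 ltr_pwDl// sqr_ge0.
have := dle _ (MD _ _ Mm (MZ (t%:C * hdot (x - m) z) _ Mz)).
rewrite opprD addrA rnorm_sub_dot => h.
have : t * (2 - t * rnorm z ^+ 2) * rnorm (hdot (x - m) z) ^+ 2 <= 0.
  by move: h md; lra.
apply/negP; rewrite -ltNge mulr_gt0// mulr_gt0// subr_gt0.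
have : t * (1 + rnorm z ^+ 2) = 1 by rewrite mulVf// gt_eqF// -invr_gt0.
by move: t0; lra.
Qed.

End HilbertGeometry.

(** * Representation of functionals and coercive forms *)

Section LaxMilgram.
Variables (R : realType) (H : hilbertType R).
Local Notation C := R[i].
Local Open Scope complex_scope.
Implicit Types x y z : H.

Lemma hdot_inj x y : (forall z, hdot x z = hdot y z) -> x = y.
Proof.
move=> xy; apply/eqP; rewrite -subr_eq0; apply/eqP/rnorm0_eq0/eqP.
by rewrite -sqrf_eq0 -Re_hdot hdotBl xy subrr.
Qed.

(** A vector orthogonal to the kernel of [f], suitably scaled, represents [f]. The
functional is antilinear because the scalar product is antilinear in its second
argument. *)
Lemma riesz_representation (f : H -> C) (M : R) :
  linear_for (Num.conj \; *%R) f -> (forall x, rnorm (f x : C) <= M * rnorm x) ->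
  exists w, forall x, f x = hdot w x.
Proof.
move=> flin fM.
have fD x y : f (x + y) = f x + f y by rewrite -[x]scale1r flin /= conjC1 mul1r scale1r.
have f0 : f 0 = 0 by apply: (addrI (f 0)); rewrite -fD !addr0.
have fZ c x : f (c *: x) = (c^*)%R * f x by rewrite -[c *: x]addr0 flin f0 addr0.
have fB x y : f (x - y) = f x - f y.
  by rewrite -scaleN1r fD fZ rmorphN /= conjC1 mulN1r.
have M0 : 0 < 1 + `|M| by rewrite ltr_pwDl.
have fM' x : rnorm (f x : C) <= (1 + `|M|) * rnorm x.
  rewrite (le_trans (fM x))// ler_wpM2r ?rnorm_ge0//.
  by rewrite (le_trans (ler_norm M))// lerDr.
pose N := [set x | f x = 0].
have sN : subspace N.
  split=> [//|x y|c x]; rewrite /N /=.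
    by rewrite fD => -> ->; rewrite addr0.
  by rewrite fZ => ->; rewrite mulr0.
have cN : closed N.
  move=> x /closure_rnormP xN; apply/(@rnorm_le_eps _ C) => e e0.
  have [|y fy xy] := xN (e / (1 + `|M|)); first by rewrite divr_gt0.
  move: xy; rewrite ltr_pdivlMr// mulrC; apply: le_lt_trans.
  by rewrite (le_trans _ (fM' _))// fB fy subr0.
have [fE|/existsNP[x fx]] := pselect (forall x, f x = 0).
  by exists 0 => x; rewrite fE hdot0l.
have [m Nm orth] := projection_theorem sN cN x.
pose e := x - m.
have fe : f e = f x by rewrite fB Nm subr0.
have fe0 : f e != 0 by rewrite fe; apply/eqP.
have e0 : hdot e e != 0.
  rewrite hdot_rnorm; apply: contra_neq fe0 => /complexI/eqP.
  by rewrite sqrf_eq0 => /eqP/rnorm0_eq0 ->.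
exists ((f e / hdot e e) *: e) => y.
have : N (y - (f y / f e)^*%R *: e).
  by rewrite /N /= fB fZ conjCK divfK// subrr.
move/orth; rewrite -/e hdotBr hdotZr conjCK hdotZl => /subr0_eq ->.
by field; rewrite fe0.
Qed.

(** If [B] is the operator with [(B x | y) = b(x, y)], coercivity gives
[|B x| >= |x|], so the range of [B] is closed; a vector [e] orthogonal to it
satisfies [b(e, e) = 0] and vanishes. Hence [B] is onto. *)
Theorem lax_milgram (b : {sesqui H}) (M : R) (f : H -> C) (K : R) :
  (forall x y, rnorm (b x y : C) <= M * rnorm x * rnorm y) ->
  (forall x, rnorm x ^+ 2 <= complex.Re (b x x)) ->
  linear_for (Num.conj \; *%R) f -> (forall x, rnorm (f x : C) <= K * rnorm x) ->
  exists u, forall x, b u x = f x.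
Proof.
move=> bM bco flin fK.
have /choice[B BE] : forall u, exists w, forall v, b u v = hdot w v.
  move=> u; apply: (@riesz_representation _ (M * rnorm u)) => [c v w|v].
    by rewrite linearPr.
  exact: bM.
have BD u v : B (u + v) = B u + B v.
  by apply: hdot_inj => z; rewrite -BE linearDl !BE -linearDl.
have BZ c u : B (c *: u) = c *: B u.
  by apply: hdot_inj => z; rewrite -BE linearZl_LR !BE -linearZl_LR.
have BB u v : B (u - v) = B u - B v by rewrite -scaleN1r BD BZ scaleN1r.
have B0 : B 0 = 0 by have := BB 0 0; rewrite !subrr.
have Bge u : rnorm u <= rnorm (B u).
  have [->|u0] := eqVneq u 0; first by rewrite B0.
  have up : 0 < rnorm u.
    by rewrite lt_def rnorm_ge0 andbT; apply: contra_neq u0; exact: rnorm0_eq0.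
  rewrite -(ler_pM2r up) -expr2 (le_trans (bco u))// BE.
  by rewrite (le_trans (ler_norm _))// (le_trans (Re_le_rnorm _))// cauchy_schwarz.
have Ble u : rnorm (B u) <= `|M| * rnorm u.
  have [Bu0|Bu0] := eqVneq (rnorm (B u)) 0.
    by rewrite Bu0 mulr_ge0 ?rnorm_ge0.
  have up : 0 < rnorm (B u) by rewrite lt_def rnorm_ge0 andbT.
  rewrite -(ler_pM2r up) -expr2 -Re_hdot -BE.
  rewrite (le_trans (ler_norm _))// (le_trans (Re_le_rnorm _))//.
  rewrite (le_trans (bM _ _))// ler_wpM2r ?rnorm_ge0// ler_wpM2r ?rnorm_ge0//.
  exact: ler_norm.
have sB : subspace (range B).
  split=> [|_ _ [u _ <-] [v _ <-]|c _ [u _ <-]]; first by exists 0.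
  - by exists (u + v).
  - by exists (c *: u).
have cB : closed (range B).
  move=> y /closure_rnormP yB.
  have /choice[u uP] : forall n : nat, exists u, rnorm (y - B u) < n.+1%:R^-1.
    move=> n; have [|_ [u _ <-] yu] := yB n.+1%:R^-1; first by rewrite invr_gt0.
    by exists u.
  have [|l ul] := @rnorm_cauchy _ _ u.
    move=> e e0; have [N _ Nlt] := @near_infty_natSinv_lt R (PosNum (divr_gt0 e0 (ltr0n R 2))).
    exists N => n m Nn Nm; apply: (le_lt_trans (Bge _)); rewrite BB.
    apply: (le_lt_trans (rnorm_triangle y _ _)); rewrite rnormBC.
    have := Nlt n Nn; have := Nlt m Nm => /=; have := uP n; have := uP m.
    by move: (n.+1%:R^-1) (m.+1%:R^-1) => e1 e2; lra.
  exists l => //; apply/eqP; rewrite -subr_eq0; apply/eqP/rnorm_le_eps => e e0.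
  have M0 : 0 < 1 + `|M| by rewrite ltr_pwDl.
  have [N1 _ h1] := ul (e / 2 / (1 + `|M|)) ltac:(by rewrite !divr_gt0).
  have [N2 _ h2] := @near_infty_natSinv_lt R (PosNum (divr_gt0 e0 (ltr0n R 2))).
  pose n := maxn N1 N2.
  have := h1 n (leq_maxl _ _); have /= := h2 n (leq_maxr _ _).
  rewrite (ltr_pdivlMr _ _ M0) => g2 g3.
  apply: (le_lt_trans (rnorm_triangle (B (u n)) _ _)).
  have := uP n; rewrite (rnormBC _ y) -BB => g1.
  have g4 : rnorm (B (l - u n)) <= (1 + `|M|) * rnorm (l - u n).
    by rewrite (le_trans (Ble _))// ler_wpM2r ?rnorm_ge0// lerDr.
  by move: g1 g2 g3 g4; move: (n.+1%:R^-1) => e1; lra.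
have [w wE] := riesz_representation flin fK.
have [_ [u _ <-] orth] := projection_theorem sB cB w.
exists u => v; rewrite wE BE; congr (hdot _ v).
apply/esym/eqP; rewrite -subr_eq0; apply/eqP/rnorm0_eq0/eqP.
rewrite -sqrf_eq0 eq_le sqr_ge0 andbT (le_trans (bco _))// BE.
by rewrite hdot_conj orth ?conjC0//; exists (w - B u).
Qed.

End LaxMilgram.

(** * Forms in a Hilbert space *)

Section FormSum.
Variables (R : realType) (H : hilbertType R) (E : lmodType R[i]).
Local Notation C := R[i].
Local Open Scope complex_scope.

(** On the diagonal its real part is the squared seminorm of the form domain. *)
Definition graph_form (s : E -> E -> C) (j : E -> H) (x y : E) : C :=
  s x y + hdot (j x) (j y).

Lemma graph_form_linear_l (s : {sesqui E}) (j : {linear E -> H}) y :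
  linear_for *%R ((graph_form s j)^~ y).
Proof.
by move=> c u v; rewrite /graph_form linearPl linearP hdotDl hdotZl /=; ring.
Qed.

Lemma graph_form_linear_r (s : {sesqui E}) (j : {linear E -> H}) x :
  linear_for (Num.conj \; *%R) (graph_form s j x).
Proof.
by move=> c u v; rewrite /graph_form linearPr linearP hdotDr hdotZr /=; ring.
Qed.

HB.instance Definition _ (s : {sesqui E}) (j : {linear E -> H}) :=
  bilinear_isBilinear.Build C E E C *%R (Num.conj \; *%R) (graph_form s j)
    (graph_form_linear_l s j, graph_form_linear_r s j).

Lemma shift_form_linear_l (gamma : R) (s : {sesqui E}) (j : {linear E -> H}) y :
  linear_for *%R ((shift_form gamma s j)^~ y).
Proof.
by move=> c u v; rewrite /shift_form linearPl linearP hdotDl hdotZl /=; ring.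
Qed.

Lemma shift_form_linear_r (gamma : R) (s : {sesqui E}) (j : {linear E -> H}) x :
  linear_for (Num.conj \; *%R) (shift_form gamma s j x).
Proof.
by move=> c u v; rewrite /shift_form linearPr linearP hdotDr hdotZr /=; ring.
Qed.

HB.instance Definition _ (gamma : R) (s : {sesqui E}) (j : {linear E -> H}) :=
  bilinear_isBilinear.Build C E E C *%R (Num.conj \; *%R) (shift_form gamma s j)
    (shift_form_linear_l gamma s j, shift_form_linear_r gamma s j).

Lemma Re_semi_inner (s : E -> E -> C) (j : E -> H) x :
  complex.Re (semi_inner s j x x) = complex.Re (s x x) + rnorm (j x) ^+ 2.
Proof.
rewrite /semi_inner ReD Re_hdot; congr (_ + _).
rewrite /real_part_form mulrC (_ : 2^-1 = (2^-1 : R)%:C); last first.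
  by rewrite fmorphV rmorph_nat.
by rewrite ReZ ReD ReJ; lra.
Qed.

Lemma Re_graph_form (s : E -> E -> C) (j : E -> H) x :
  complex.Re (graph_form s j x x) = complex.Re (s x x) + rnorm (j x) ^+ 2.
Proof. by rewrite ReD Re_hdot. Qed.

End FormSum.

Section Continuity.
Variable R : realType.
Local Notation C := R[i].
Local Open Scope complex_scope.

Lemma continuous_rnorm (V : normedModType C) : continuous (@rnorm R V).
Proof.
move=> x; apply/cvgrPdist_lt => e e0; apply/nbhs_rnormP; exists e => // y.
apply: le_lt_trans.
have := rnormD (x - y) y; have := rnormD (y - x) x.
by rewrite !subrK (rnormBC y) ler_norml; lra.
Qed.

Lemma continuous_Re : continuous (@complex.Re R : C -> R).
Proof.
move=> z; apply/(@cvgrPdist_lt _ _ _ _ (nbhs_filter (z : C))) => e e0.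
apply/nbhs_rnormP; exists e => // w.
by apply: le_lt_trans; rewrite -ReB; exact: Re_le_rnorm.
Qed.

Lemma dense_closed (T : topologicalType) (S A : set T) :
  dense S -> closed A -> S `<=` A -> forall x, A x.
Proof.
move=> dS cA SA x; apply: contrapT => nAx.
have [|y [nAy /SA//]] := dS (~` A) _ (closed_openC cA).
by exists x.
Qed.

(** Continuity at the origin bounds the form on a small ball, and homogeneity then
bounds it everywhere. *)
Lemma continuous_sesqui_bounded (V : normedModType C) (s : {sesqui V}) :
  continuous (fun p : V * V => s p.1 p.2 : C) ->
  exists2 M, 0 < M & forall x y, rnorm (s x y : C) <= M * rnorm x * rnorm y.
Proof.
move=> /(_ (0, 0)) /cvg_rnormP /(_ 1 ltr01) [[A B] [/= /nbhs_rnormP[d1 d10 A1]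
  /nbhs_rnormP[d2 d20 B1]] AB].
pose d := Num.min d1 d2 / 2.
have d0 : 0 < d by rewrite divr_gt0// lt_min d10.
have small x y : rnorm x <= d -> rnorm y <= d -> rnorm (s x y : C) <= 1.
  have dd : d < Num.min d1 d2 by rewrite /d; move: d0; rewrite /d; lra.
  move=> xd yd; have := AB (x, y); rewrite /= linear0l sub0r rnormN => h.
  apply/ltW/h; split; [apply: A1|apply: B1]; rewrite sub0r rnormN.
    by rewrite (le_lt_trans xd)// (lt_le_trans dd)// ge_min lexx.
  by rewrite (le_lt_trans yd)// (lt_le_trans dd)// ge_min lexx orbT.
exists (d ^- 2) => [|x y]; first by rewrite invr_gt0 exprn_gt0.
have [x0|x0] := eqVneq (rnorm x) 0.
  by rewrite (rnorm0_eq0 x0) linear0l !rnorm0 mulr0 mul0r.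
have [y0|y0] := eqVneq (rnorm y) 0.
  by rewrite (rnorm0_eq0 y0) linear0r !rnorm0 mulr0.
have xp : 0 < rnorm x by rewrite lt_def x0 rnorm_ge0.
have yp : 0 < rnorm y by rewrite lt_def y0 rnorm_ge0.
have := small ((d / rnorm x)%:C *: x) ((d / rnorm y)%:C *: y).
have dge r : 0 < r -> 0 <= d / r by move=> r0; rewrite divr_ge0 ?ltW.
rewrite (rnormZr _ (dge _ xp)) (rnormZr _ (dge _ yp)) !divfK// lexx.
move=> /(_ isT isT); rewrite linearZl_LR linearZr_LR /= conj_real mulrA -rmorphM.
rewrite rnormM rnorm_real ger0_norm; last by rewrite mulr_ge0// divr_ge0 ?rnorm_ge0 ?ltW.
rewrite -ler_pdivlMl; last by rewrite mulr_gt0// divr_gt0.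
rewrite mulr1 => /le_trans; apply; rewrite le_eqVlt; apply/orP; left.
by apply/eqP; field; rewrite x0 y0 gt_eqF.
Qed.

End Continuity.

(** * The resolvent of the relation associated with a form *)

Section Resolvent.
Variables (R : realType) (H : hilbertType R) (E : lmodType R[i]).
Local Notation C := R[i].
Local Open Scope complex_scope.
Variables (b : E -> E -> C) (j : E -> H) (B : set (H * H)).
Hypothesis b_ge0 : forall u, 0 <= complex.Re (b u u).

Section Completion.
Variables (V : hilbertType R) (q : {linear E -> V}) (jt : {linear V -> H}).
Variable at_ : {sesqui V}.
Hypothesis q_compl : is_completion b j q.
Hypothesis jt_cont : continuous jt.
Hypothesis jtq : forall x, jt (q x) = j x.
Hypothesis at_cont : continuous (fun p : V * V => at_ p.1 p.2).
Hypothesis atq : forall x y, at_ (q x) (q y) = b x y.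

Let dense_q : dense (range q). Proof. by case: q_compl. Qed.

Lemma continuous_quadratic : continuous (fun u => complex.Re (at_ u u)).
Proof.
move=> u; apply: (@continuous_comp _ _ _ (fun u => at_ u u : C) (@complex.Re R)).
  apply: (@continuous_comp _ _ _ (fun u => (u, u)) (fun p : V * V => at_ p.1 p.2)).
    by apply: cvg_pair; exact: cvg_id.
  exact: at_cont.
exact: continuous_Re.
Qed.

Lemma completion_ge0 u : 0 <= complex.Re (at_ u u).
Proof.
apply: (dense_closed (A := [set u | 0 <= complex.Re (at_ u u)]) dense_q) => [|_ [x _ <-]].
  exact: (iffLR (continuous_closedP _) continuous_quadratic _ (@closed_ge _ 0)).
by rewrite /= atq.
Qed.

Lemma completion_rnorm x : rnorm (q x) ^+ 2 = complex.Re (b x x) + rnorm (j x) ^+ 2.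
Proof. by rewrite -Re_hdot -Re_semi_inner; case: q_compl => _ ->. Qed.

(** The two sides are continuous and agree on the dense range of [q]. This identity
is the coercivity needed for the Lax-Milgram theorem, with constant one. *)
Lemma completion_norm u : rnorm u ^+ 2 = complex.Re (graph_form at_ jt u u).
Proof.
rewrite Re_graph_form; apply/eqP; rewrite -subr_eq0; apply/eqP.
pose g u := rnorm u ^+ 2 - (complex.Re (at_ u u) + rnorm (jt u) ^+ 2).
apply: (dense_closed (A := [set u | g u = 0]) dense_q) => [|_ [x _ <-]].
  have csq (f : V -> R) : continuous f -> continuous (fun u => f u ^+ 2).
    by move=> cf v; apply: (@continuous_comp _ _ _ f (fun r : R => r ^+ 2)); [exact: cf|exact: exprn_continuous].
  have cg : continuous g.
    move=> v; rewrite /continuous_at /g; apply: cvgB.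
      by apply: csq; exact: continuous_rnorm.
    apply: cvgD; first exact: continuous_quadratic.
    apply: csq => w; apply: (@continuous_comp _ _ _ jt (@rnorm R H)); first exact: jt_cont.
    exact: continuous_rnorm.
  exact: (iffLR (continuous_closedP _) cg _ (@closed_eq _ 0)).
by rewrite /= /g completion_rnorm jtq atq subrr.
Qed.

Lemma completion_rnorm_le u : rnorm (jt u) <= rnorm u.
Proof.
rewrite -(@ler_pXn2r _ 2)// ?nnegrE ?rnorm_ge0// completion_norm Re_graph_form.
by rewrite lerDr completion_ge0.
Qed.

Lemma completion_orth y : (forall v, hdot y (j v) = 0) ->
  forall v, hdot y (jt v) = 0.
Proof.
move=> yj v.
apply: (dense_closed (A := [set v | hdot y (jt v) = 0]) dense_q) => [|_ [x _ <-]]; last first.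
  by rewrite /= jtq yj.
move=> u /closure_rnormP uA; apply/(@rnorm_le_eps _ C) => e e0.
have y1 : 0 < 1 + rnorm y by rewrite ltr_pwDl// rnorm_ge0.
have [|w /= yw] := uA (e / (1 + rnorm y)); first by rewrite divr_gt0.
rewrite ltr_pdivlMr//; apply: le_lt_trans.
rewrite -[hdot _ _]subr0 -yw -hdotBr -linearB mulrC.
rewrite (le_trans (cauchy_schwarz _ _))// ler_pM ?rnorm_ge0// ?lerDr//.
exact: completion_rnorm_le.
Qed.

Lemma completion_solve y : exists u, forall v, graph_form at_ jt u v = hdot y (jt v).
Proof.
have [M M0 atM] := continuous_sesqui_bounded at_cont.
apply: (@lax_milgram _ _ _ (M + 1) _ (rnorm y)) => [u v|u|c u v|v].
- rewrite /graph_form (le_trans (rnormD _ _))// 2!mulrDl lerD// mul1r.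
  by rewrite (le_trans (cauchy_schwarz _ _))// ler_pM ?rnorm_ge0// completion_rnorm_le.
- by rewrite completion_norm.
- by rewrite linearP hdotDr hdotZr.
- by rewrite (le_trans (cauchy_schwarz _ _))// ler_wpM2l ?rnorm_ge0// completion_rnorm_le.
Qed.

Lemma completion_definite u : graph_form at_ jt u u = 0 -> u = 0.
Proof.
by move=> u0; apply/rnorm0_eq0/eqP; rewrite -sqrf_eq0 completion_norm u0.
Qed.

End Completion.

Hypothesis BA : associated_sectorial b j B.

Lemma associated_accretive x z : B (x, z) -> 0 <= complex.Re (hdot z x).
Proof.
have [V [q [jt [at_ [qc [jc jq] [ac aq] ->]]]]] := BA.
by move=> [u /= [<- <-]]; exact: completion_ge0 qc ac aq u.
Qed.

(** The multivalued part of the relation consists of the vectors orthogonal to the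
range of [j], because [j u = 0] and [b(u, u) = 0] force [u = 0] in the
completion. *)
Lemma associated_mul0 y : B (0, y) <-> forall v, hdot y (j v) = 0.
Proof.
have [V [q [jt [at_ [qc [jc jq] [ac aq] ->]]]]] := BA.
split=> [[u /= [u0 uE]] v|/(completion_orth qc jc jq ac aq) yj].
  have -> : y = 0 *: y + y by rewrite scale0r add0r.
  rewrite -jq hdotDl hdotZl mul0r add0r -uE (_ : u = 0) ?linear0l//.
  apply: (completion_definite qc jc jq ac aq).
  by rewrite /graph_form uE u0 hdot0r hdot0l addr0.
exists 0; split=> [|v]; first exact: linear0.
by rewrite linear0l /= yj.
Qed.

(** What is kept of [Q = (1 + B)^-1] once the completion is forgotten. The first two
clauses say that [Q] is that inverse; the third will make the range of [Q] dense.
By the last, [Q y] is [j z] up to a small error for some [z] in the original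
domain that solves the variational problem up to a small error; this is how the
resolvents of two forms with different completions are compared. *)
Definition is_resolvent (Rs : H -> H) :=
  [/\ forall y, B (Rs y, y - Rs y),
      forall x z, B (x, z) -> Rs (x + z) = x,
      forall y, hdot y (Rs y) = 0 -> B (0, y) &
      forall y (e : R), 0 < e -> exists2 z, rnorm (j z - Rs y) < e &
        forall v, rnorm (graph_form b j z v - hdot y (j v) : C) <=
          e * (1 + complex.Re (graph_form b j v v))].

(** The resolvent sends [y] to [j u], where [u] is the Lax-Milgram solution in the
completion; an element of the original domain close enough to [u] is the
approximate solution. *)
Theorem exists_resolvent : exists Rs : {linear H -> H}, is_resolvent Rs.
Proof.
have [V [q [jt [at_ [qc [jc jq] [ac aq] BE]]]]] := BA.
have /choice[S SE] := completion_solve qc jc jq ac aq.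
have Suniq u y : (forall v, graph_form at_ jt u v = hdot y (jt v)) -> u = S y.
  move=> uy; apply/eqP; rewrite -subr_eq0; apply/eqP.
  apply: (completion_definite qc jc jq ac aq).
  by rewrite linearBl /= uy SE subrr.
have Slin : linear (jt \o S).
  move=> c x y /=; rewrite -linearP; congr (jt _); apply/esym/Suniq => v.
  by rewrite linearPl /= !SE hdotDl hdotZl.
pose Rs : {linear H -> H} := HB.pack (jt \o S) (GRing.isLinear.Build _ _ _ _ _ Slin).
exists Rs; split=> [y|x z|y|y e e0].
- rewrite BE /=; exists (S y); split=> // v.
  by rewrite hdotBl -SE /graph_form addrK.
- rewrite BE => -[u /= [<- uE]]; congr (jt _); apply/esym/Suniq => v.
  by rewrite /graph_form uE addrC -hdotDl.
- move=> yS; apply/associated_mul0 => v.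
  have S0 : S y = 0.
    by apply: (completion_definite qc jc jq ac aq); rewrite SE.
  by rewrite -jq -SE S0 linear0l.
have [M M0 atM] := continuous_sesqui_bounded ac.
have e'0 : 0 < e / (M + 1) by rewrite divr_gt0// addr_gt0.
have /closure_rnormP/(_ _ e'0)[_ [z _ <-]] := dense_closed
  (A := closure (range q)) qc.1 (@closed_closure _ _) (@subset_closure _ _) (S y).
rewrite ltr_pdivlMr ?addr_gt0// rnormBC mulrDr mulr1 => zS.
have zS0 := rnorm_ge0 (q z - S y); have zSM := mulr_ge0 zS0 (ltW M0).
exists z => [|v].
  rewrite -jq /= -linearB (le_lt_trans (completion_rnorm_le qc jc jq ac aq _))//.
  by rewrite (le_lt_trans _ zS)// lerDr.
have -> : graph_form b j z v - hdot y (j v) = graph_form at_ jt (q z - S y) (q v).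
  by rewrite linearBl /= SE /graph_form aq !jq.
rewrite Re_graph_form -(completion_rnorm qc).
have qv0 := rnorm_ge0 (q v).
have qvle : rnorm (q v) <= 1 + rnorm (q v) ^+ 2.
  by have := sqr_ge0 (rnorm (q v) - 1); have := sqr_ge0 (rnorm (q v)); rewrite sqrrB1; lra.
apply: (@le_trans _ _ (e * rnorm (q v))); last by rewrite ler_wpM2l// ltW.
apply: (@le_trans _ _ ((rnorm (q z - S y) * M + rnorm (q z - S y)) * rnorm (q v))); last first.
  by rewrite ler_wpM2r// ltW.
rewrite (le_trans (rnormD _ _))// mulrDl lerD//.
  by rewrite [_ * M]mulrC.
rewrite (le_trans (cauchy_schwarz _ _))// ler_pM ?rnorm_ge0//.
  exact: (completion_rnorm_le qc jc jq ac aq).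
exact: (completion_rnorm_le qc jc jq ac aq).
Qed.

End Resolvent.

(** * Comparison of a form with a larger one *)

Lemma ler_normN (R : realDomainType) (x : R) : - x <= `|x|.
Proof. by rewrite -normrN ler_norm. Qed.

Section Perturbation.
Variable R : realType.
Local Notation C := R[i].
Local Open Scope complex_scope.
Variables (E F : lmodType C) (iota : {linear F -> E}).

Definition diff_form (sF : F -> F -> C) (s : E -> E -> C) (u v : F) : C :=
  sF u v - s (iota u) (iota v).

Lemma diff_form_linear_l (sF : {sesqui F}) (s : {sesqui E}) v :
  linear_for *%R ((diff_form sF s)^~ v).
Proof.
by move=> c u w; rewrite /diff_form (linearP iota) !linearPl /=; ring.
Qed.

Lemma diff_form_linear_r (sF : {sesqui F}) (s : {sesqui E}) u :
  linear_for (Num.conj \; *%R) (diff_form sF s u).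
Proof.
by move=> c v w; rewrite /diff_form (linearP iota) !linearPr /=; ring.
Qed.

HB.instance Definition _ (sF : {sesqui F}) (s : {sesqui E}) :=
  bilinear_isBilinear.Build C F F C *%R (Num.conj \; *%R) (diff_form sF s)
    (diff_form_linear_l sF s, diff_form_linear_r sF s).

(** The form of Cauchy-Schwarz inequality supplied by [sesqui_young]. Keeping [t]
free allows the second term to be absorbed by an energy. *)
Definition young_bounded (G : lmodType C) (s : G -> G -> C) (K : R) :=
  (forall u, 0 <= complex.Re (s u u)) /\
  forall u v t, 0 < t -> rnorm (s u v : C) <=
    K * (t * complex.Re (s u u) + t^-1 * complex.Re (s v v)).

(** Here [w] solves the variational problem for [s] up to an error, [z] does so for
the larger form [s + d], and [w'] is any competitor. Subtracting the two
problems and testing with [v = z - w'] expresses the energy of [v] through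
[s(w - w', v)], [d(w', v)] and the errors; all terms in [v] are absorbed in the
left-hand side. *)
Lemma galerkin_estimate (s : {sesqui E}) (d : {sesqui F}) (K : R) (f : E -> C)
    (e : R) (w : E) (z w' : F) :
  0 < K -> young_bounded s K -> young_bounded d K -> 0 <= e <= 8^-1 ->
  (forall v, rnorm (s w v - f v : C) <= e * (1 + complex.Re (s v v))) ->
  (forall v, rnorm (s (iota z) (iota v) + d z v - f (iota v) : C) <=
     e * (1 + complex.Re (s (iota v) (iota v)) + complex.Re (d v v))) ->
  complex.Re (s (iota (z - w')) (iota (z - w'))) <=
    4 * e + 8 * K ^+ 2 * (complex.Re (s (w - iota w') (w - iota w')) +
                          complex.Re (d w' w')).
Proof.
move=> K0 [s0 sK] [d0 dK] /andP[e0 e1] sw dz.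
pose v := z - w'.
pose x1 := s (iota z) (iota v) + d z v - f (iota v).
pose x2 := s w (iota v) - f (iota v).
pose x3 := s (w - iota w') (iota v); pose x4 := d w' v.
have split_v : s (iota v) (iota v) + d v v = x1 - x2 + x3 - x4.
  rewrite /x1 /x2 /x3 /x4 {1 3}/v [iota (z - w')]linearB /= !linearBl /=; ring.
have ReA (a b c k : C) : complex.Re (a - b + c - k) =
    complex.Re a - complex.Re b + complex.Re c - complex.Re k.
  by rewrite !(ReD, ReN).
have := congr1 (@complex.Re R) split_v; rewrite ReA ReD.
(* For this [t] the terms in [v] add up to a quarter of the energy of [v]. *)
have t0 : 0 < 4 * K by rewrite mulr_gt0.
have KK x y : K * (4 * K * x + (4 * K)^-1 * y) = 4 * K ^+ 2 * x + 4^-1 * y.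
  by field; rewrite gt_eqF.
have := le_trans (le_trans (ler_norm _) (Re_le_rnorm x1)) (dz v).
have := le_trans (le_trans (ler_normN _) (Re_le_rnorm x2)) (sw (iota v)).
have := le_trans (le_trans (ler_norm _) (Re_le_rnorm x3)) (sK (w - iota w') (iota v) _ t0).
have := le_trans (le_trans (ler_normN _) (Re_le_rnorm x4)) (dK w' v _ t0).
have := s0 (iota v); have := d0 v; rewrite !KK -/v.
move: (complex.Re (s (iota v) _)) (complex.Re (d v v)) => p q q0 p0.
have : e * (2 * p + q) <= 8^-1 * (2 * p + q).
  by rewrite ler_wpM2r// addr_ge0// mulr_ge0.
lra.
Qed.


End Perturbation.

(** * Convergence of the resolvents *)

Section ResolventConvergence.
Variable R : realType.
Local Notation C := R[i].
Local Open Scope complex_scope.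

Lemma quadratic_le (E : lmodType C) (s : {sesqui E}) x y :
  (forall u, 0 <= complex.Re (s u u)) ->
  complex.Re (s (x + y) (x + y)) <= 2 * complex.Re (s x x) + 2 * complex.Re (s y y).
Proof.
move=> s0; have := s0 (x - y).
rewrite !(linearDl, linearNl) /= !(linearDr, linearNr) /= !(ReD, ReN); lra.
Qed.

Lemma quadraticN (E : lmodType C) (s : {sesqui E}) x : s (- x) (- x) = s x x.
Proof. by rewrite linearNl linearNr /= opprK. Qed.

Lemma sectorial_young_bounded (E : lmodType C) (s : {sesqui E}) (c c' : R) :
  c <= c' ->
  (forall u, 0 <= complex.Re (s u u) /\
     `|complex.Im (s u u)| <= c * complex.Re (s u u)) ->
  young_bounded s (1 + c').
Proof.
move=> cc' sc; split=> [u|u v t t0]; first by case: (sc u).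
have s0 u' : 0 <= complex.Re (s u' u') by case: (sc u').
have sc' u' : `|complex.Im (s u' u')| <= c * complex.Re (s u' u') by case: (sc u').
apply: (le_trans (sesqui_young s0 sc' u v t0)).
by rewrite ler_wpM2r// ?lerD2l// addr_ge0// mulr_ge0 ?invr_ge0// ltW.
Qed.

Variables (H : hilbertType R) (E : lmodType C).
Variables (b : {sesqui E}) (j : {linear E -> H}) (K : R).
Variables (F : nat -> lmodType C) (iota : forall n, {linear F n -> E}).
Variables (bF : forall n, F n -> F n -> C) (d : forall n, {sesqui (F n)}).
Hypothesis K0 : 0 < K.
Hypothesis bFE : forall n u v, bF u v = b (iota n u) (iota n v) + d n u v.
Hypothesis b0 : forall u, 0 <= complex.Re (b u u).
Hypothesis sK : young_bounded (graph_form b j) K.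
Hypothesis dK : forall n, young_bounded (d n) K.
Hypothesis approx : forall u (e : R), 0 < e -> exists u_ : forall n, F n,
  \forall n \near \oo,
    complex.Re (graph_form b j (u - iota n (u_ n)) (u - iota n (u_ n))) < e /\
    complex.Re (d n (u_ n) (u_ n)) < e.

(** The competitor [w'] of [galerkin_estimate] is the given approximation [u_ n] of an
approximate solution [w]. The seminorm dominates [j], so that smallness of the
energy of [z - u_ n] bounds the distance of the resolvents. *)
Lemma resolvent_cvg (A : set (H * H)) (Rs : H -> H) (A_ : nat -> set (H * H))
    (Rs_ : nat -> H -> H) :
  is_resolvent b j A Rs ->
  (forall n, is_resolvent (@bF n) (fun u => j (iota n u)) (A_ n) (Rs_ n)) ->
  forall y (e : R), 0 < e -> \forall n \near \oo, rnorm (Rs_ n y - Rs y) < e.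
Proof.
move=> [_ _ _ Rs_app] Rs_n y e e0.
have s0 := sK.1.
pose r : R := Num.min 8^-1 (Num.min (e / 4) (e ^+ 2 / 128)).
have r0 : 0 < r by rewrite !lt_min invr_gt0 ltr0n /= !divr_gt0// exprn_gt0.
have r1 : r <= 8^-1 by rewrite ge_min lexx.
have r2 : r <= e / 4 by rewrite !ge_min lexx orbT.
have r3 : r <= e ^+ 2 / 128 by rewrite !ge_min lexx !orbT.
have [w we wy] := Rs_app y r r0.
(* When both energies of the competitor are below [k], the energy of
   [iota z - w] is at most [10 r], which is below [(e / 2)^2]. *)
pose k := r / (2 + 16 * K ^+ 2).
have K2 : 0 < K ^+ 2 by rewrite exprn_gt0.
have k0 : 0 < k by rewrite divr_gt0// addr_gt0// mulr_gt0.
have kr : k * (2 + 16 * K ^+ 2) = r by rewrite divfK// gt_eqF// addr_gt0// mulr_gt0.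
have [u_ u_n] := approx w k0.
apply: filterS u_n => n [pn dn].
have [_ _ _ /(_ y r r0)[z ze zy]] := Rs_n n.
have := @galerkin_estimate R _ _ (iota n) (graph_form b j) (d n) K
  (fun v => hdot y (j v)) r w z (u_ n) K0 sK (dK n).
rewrite r1 (ltW r0) => /(_ isT wy).
have h v : rnorm (graph_form b j (iota n z) (iota n v) + d n z v - hdot y (j (iota n v)) : C)
   <= r * (1 + complex.Re (graph_form b j (iota n v) (iota n v)) + complex.Re (d n v v)).
  have := zy v; rewrite -[1 + _ + _]addrA -ReD.
  have gE u v' : graph_form (@bF n) (fun u => j (iota n u)) u v' =
      graph_form b j (iota n u) (iota n v') + d n u v'.
    by rewrite /graph_form bFE addrAC.
  by rewrite !gE.
move=> /(_ h); rewrite linearB.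
have jle v : rnorm (j v) ^+ 2 <= complex.Re (graph_form b j v v).
  by rewrite Re_graph_form lerDr.
move=> est.
have splitw : iota n z - w = (iota n z - iota n (u_ n)) + - (w - iota n (u_ n)).
  by rewrite opprB addrA subrK.
have := @quadratic_le _ (graph_form b j) (iota n z - iota n (u_ n))
  (- (w - iota n (u_ n))) s0.
rewrite quadraticN -splitw => /(le_trans (jle _)); rewrite linearB /= => e2.
have e3 : rnorm (j (iota n z) - j w) < e / 2.
  rewrite -(@ltr_pXn2r _ 2)// ?nnegrE ?rnorm_ge0 ?divr_ge0 ?(ltW e0)//.
  apply: (le_lt_trans e2).
  have : 16 * K ^+ 2 * (complex.Re (graph_form b j (w - iota n (u_ n)) (w - iota n (u_ n))) +
      complex.Re (d n (u_ n) (u_ n))) <= 16 * K ^+ 2 * (k + k).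
    by rewrite ler_wpM2l ?lerD ?ltW// mulr_gt0.
  have : 0 < e ^+ 2 by rewrite exprn_gt0.
  move: est kr r3 pn; rewrite exprMn (_ : 2^-1 ^+ 2 = 4^-1); last by field.
  move: (complex.Re _) (complex.Re _) (complex.Re _) (K ^+ 2) (e ^+ 2) => *; lra.
have := rnorm_triangle (j (iota n z)) (Rs_ n y) (Rs y).
have := rnorm_triangle (j w) (j (iota n z)) (Rs y).
by move: ze; rewrite (rnormBC _ (Rs_ n y)); lra.
Qed.


End ResolventConvergence.

(** * A mean value inequality for one-sided derivatives *)

Section DiniMeanValue.
Variable R : realType.
Local Notation C := R[i].

Lemma near_right0P (P : R -> Prop) :
  (\forall h \near 0^'+, P h) <->
  exists2 d : R, 0 < d & forall h, 0 < h -> h < d -> P h.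
Proof.
split=> [[d d0 dP]|[d d0 dP]].
  exists d => // h h0 hd; apply: dP => //=.
  by rewrite /ball_ sub0r normrN gtr0_norm.
exists d => // h /=; rewrite sub0r normrN => hd h0; apply: dP => //.
by rewrite -(gtr0_norm h0).
Qed.

(** The supremum of the times up to which [g r <= g 0 + (K + e) r] holds is attained
by the second hypothesis, and the first one lets it pass any point below [t]. *)
Lemma dini_mean_value (g : R -> R) (t K : R) : 0 <= t -> 0 <= K ->
  (forall s e, 0 <= s < t -> 0 < e ->
     \forall h \near 0^'+, g (s + h) <= g s + (K + e) * h) ->
  (forall s e, 0 < s <= t -> 0 < e -> \forall h \near 0^'+, g s <= g (s - h) + e) ->
  g t <= g 0 + K * t.
Proof.
move=> t0 K0 gr gl; apply/ler_addgt0Pr => e' e'0.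
pose e := e' / (1 + t); have t1 : 0 < 1 + t by rewrite ltr_pwDl.
have e0 : 0 < e by rewrite divr_gt0.
pose A := [set s | 0 <= s <= t /\ forall r, 0 <= r <= s -> g r <= g 0 + (K + e) * r].
have A0 : A 0.
  split=> [|r /andP[r0 r1]]; first by rewrite lexx t0.
  by rewrite (_ : r = 0) ?mulr0 ?addr0//; apply/eqP; rewrite eq_le r0 r1.
have Asup : has_sup A by split; [exists 0|exists t => s [/andP[]]].
pose m := sup A.
have m0 : 0 <= m by apply: ub_le_sup A0; case: Asup.
have mt : m <= t by apply: ge_sup; [exists 0|move=> s [/andP[]]].
have below r : 0 <= r < m -> g r <= g 0 + (K + e) * r.
  move=> /andP[r0 rm].
  have [|s [_ As] rs] := @sup_adherent _ A (m - r) _ Asup; first by rewrite subr_gt0.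
  by apply: As; rewrite r0 ltW//; move: rs; rewrite subKr.
have Ke : 0 <= K + e by rewrite addr_ge0// ltW.
have Am : A m.
  split=> [|r /andP[r0]]; first by rewrite m0.
  rewrite le_eqVlt => /predU1P[->|rm]; last by rewrite below ?r0.
  have [mp|mp] := ltP 0 m; last first.
    by rewrite (_ : m = 0) ?mulr0 ?addr0//; apply/eqP; rewrite eq_le m0 mp.
  apply/ler_addgt0Pr => k k0.
  have [|d d0 dP] := iffLR (near_right0P _) (gl m k _ k0); first by rewrite mp.
  pose h := Num.min d m / 2.
  have dm : 0 < Num.min d m by rewrite lt_min d0.
  have hd : h < Num.min d m by rewrite /h; move: dm; lra.
  move: hd; rewrite lt_min => /andP[hd hm].
  have h0 : 0 < h by rewrite divr_gt0.
  apply: (le_trans (dP h h0 hd)); rewrite lerD2r.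
  apply: (@le_trans _ _ (g 0 + (K + e) * (m - h))).
    by apply: below; rewrite subr_ge0 (ltW hm)/= ltrBlDr ltrDl.
  by rewrite lerD2l ler_wpM2l// lerBlDr lerDl ltW.
suff tm : t <= m.
  have -> : g 0 + K * t + e' = g 0 + (K + e) * t + e.
    by rewrite /e; field; rewrite gt_eqF.
  by apply: (le_trans (Am.2 t _)); rewrite ?t0// lerDl ltW.
rewrite leNgt; apply/negP => mlt.
have [|d d0 dP] := iffLR (near_right0P _) (gr m e _ e0); first by rewrite m0.
pose h := Num.min d (t - m) / 2.
have dm : 0 < Num.min d (t - m) by rewrite lt_min d0 subr_gt0.
have hd : h < Num.min d (t - m) by rewrite /h; move: dm; lra.
move: hd; rewrite lt_min => /andP[hd hm].
have h0 : 0 < h by rewrite divr_gt0.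
suff Ah : A (m + h).
  suff : m + h <= m by rewrite gerDl leNgt h0.
  by apply: ub_le_sup Ah; case: Asup.
split=> [|r /andP[r0 rh]].
  by rewrite addr_ge0 ?(ltW h0)//= addrC -lerBrDr ltW.
have [rm|mr] := lerP r m; first by apply: Am.2; rewrite r0.
have rE : r = m + (r - m) by rewrite addrC subrK.
rewrite rE (le_trans (dP _ _ _))//; first by rewrite subr_gt0.
  by rewrite (le_lt_trans _ hd)// lerBlDl.
by rewrite [X in _ <= g 0 + X]mulrDr addrA lerD2r; apply: Am.2; rewrite m0 lexx.
Qed.

Lemma vector_dini_mean_value (V : normedModType C) (f : R -> V) (t K : R) :
  0 <= t -> 0 <= K ->
  (forall s e, 0 <= s < t -> 0 < e ->
     \forall h \near 0^'+, rnorm (f (s + h) - f s) <= (K + e) * h) ->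
  (forall s e, 0 < s <= t -> 0 < e ->
     \forall h \near 0^'+, rnorm (f s - f (s - h)) <= e) ->
  rnorm (f t - f 0) <= K * t.
Proof.
move=> t0 K0 fr fl.
have -> : K * t = rnorm (f 0 - f 0) + K * t by rewrite subrr rnorm0 add0r.
apply: (@dini_mean_value (fun s => rnorm (f s - f 0))) => // s e st e0.
  apply: filterS (fr s e st e0) => h fh.
  by rewrite (le_trans (rnorm_triangle (f s) _ _))// [X in _ <= X]addrC lerD2r.
apply: filterS (fl s e st e0) => h fh.
by rewrite (le_trans (rnorm_triangle (f (s - h)) _ _))// [X in _ <= X]addrC lerD2r.
Qed.

End DiniMeanValue.

(** * Local boundedness of strongly continuous semigroups *)

Section SemigroupBound.
Variables (R : realType) (X : completeNormedModType R[i]).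
Local Notation C := R[i].
Local Open Scope complex_scope.
Implicit Types (T : R -> {linear X -> X}) (x y : X).

(** The category argument of the uniform boundedness principle. If no bound held near
time zero, there would be nested balls with radii tending to zero and times
[t_n] tending to zero with [|T(t_n) y| > n] on the [n]-th ball; the common point
of the balls contradicts strong continuity at zero. *)
Lemma semigroup_near0_bounded T : degenerate_semigroup T ->
  exists2 d : R, 0 < d & exists2 M, 1 <= M &
    forall t x, 0 <= t -> t < d -> rnorm (T t x) <= M * rnorm x.
Proof.
move=> [Tcont _ T0]; apply: contrapT => unb.
have unbounded x r n : 0 < r -> exists t y,
    [/\ 0 <= t, t < n.+1%:R^-1, rnorm (x - y) < r & n%:R < rnorm (T t y)].
  move=> r0; apply: contrapT => nex; apply: unb.
  exists n.+1%:R^-1; first by rewrite invr_gt0.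
  have Tn t y : 0 <= t -> t < n.+1%:R^-1 -> rnorm (x - y) < r -> rnorm (T t y) <= n%:R.
    by move=> t0 tn xy; rewrite leNgt; apply/negP => Ty; apply: nex; exists t, y.
  exists (1 + 4 * n%:R / r); first by rewrite lerDl divr_ge0 ?mulr_ge0 ?(ltW r0).
  move=> t z t0 tn; have [z0|z0] := eqVneq (rnorm z) 0.
    by rewrite (rnorm0_eq0 z0) linear0 !rnorm0 mulr0.
  have zp : 0 < rnorm z by rewrite lt_def z0 rnorm_ge0.
  pose k := r / 2 / rnorm z; have k0 : 0 < k by rewrite !divr_gt0.
  have h1 : rnorm (T t (x - k%:C *: z)) <= n%:R.
    apply: Tn => //; rewrite opprB addrC subrK rnormZr ?ltW// divfK//.
    by rewrite ltr_pdivrMr// ltr_pMr// ltr1n.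
  have h2 : rnorm (T t x) <= n%:R by apply: Tn => //; rewrite subrr rnorm0.
  have : k * rnorm (T t z) <= 2 * n%:R.
    rewrite -(rnormZr _ (ltW k0)) -linearZ.
    have -> : k%:C *: z = x - (x - k%:C *: z) by rewrite opprB addrC subrK.
    rewrite linearB /= (le_trans (rnormB _ _))// mulrDl mul1r lerD//.
  rewrite -ler_pdivlMl// => /le_trans; apply.
  rewrite [X in _ <= X]mulrDl mul1r ler_wpDl ?rnorm_ge0// le_eqVlt; apply/orP; left.
  by apply/eqP; rewrite /k; field; rewrite z0 gt_eqF.
(* Balls are pairs of a centre and a radius; requiring the radii to fit, and not
   only the balls to be nested, lets the inclusions be summed along the sequence. *)
pose next n (p q : X * R) (t : R) := [/\ 0 < q.2, q.2 <= n.+1%:R^-1,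
  rnorm (p.1 - q.1) + q.2 <= p.2, 0 <= t < n.+1%:R^-1 &
  forall y, rnorm (q.1 - y) <= q.2 -> n%:R < rnorm (T t y)].
have /choice[f fP] : forall np : nat * (X * R), exists qt : (X * R) * R,
    0 < np.2.2 -> next np.1 np.2 qt.1 qt.2.
  move=> [n [x r]] /=; have [r0|_] := ltP 0 r; last by exists ((x, r), 0).
  have [t [y [t0 tn xy Ty]]] := unbounded x r n r0.
  have [|d d0 dy] := iffLR (continuous_rnormP _ _) (Tcont t t0 y) (rnorm (T t y) - n%:R).
    by rewrite subr_gt0.
  pose m := Num.min d (Num.min (r - rnorm (x - y)) n.+1%:R^-1).
  have m0 : 0 < m by rewrite !lt_min d0 subr_gt0 xy/= invr_gt0 ltr0n.
  have m2 : m / 2 < m by move: m0; lra.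
  have := m2; rewrite {2}/m !lt_min => /and3P[md mr mn].
  exists ((y, m / 2), t) => _; split => //=.
  - by rewrite divr_gt0.
  - exact: ltW.
  - by rewrite addrC -lerBrDr ltW.
  - by rewrite t0.
  - move=> z yz; have := dy z (le_lt_trans yz md).
    have := rnormD (T t y - T t z) (T t z); rewrite subrK; lra.
have [u [u_0 uS]] : exists u : nat -> X * R,
    u 0 = (0, 1) /\ forall n, u n.+1 = (f (n, u n)).1.
  by exists (fix u n := if n is n'.+1 then (f (n', u n')).1 else (0, 1)).
have u0 n : 0 < (u n).2.
  elim: n => [|n IH] /=; first by rewrite u_0 ltr01.
  by rewrite uS; have [] := fP (n, u n) IH.
have un n : next n (u n) (u n.+1) (f (n, u n)).2 by rewrite uS; exact: fP (n, u n) (u0 n).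
have nested n m : (n <= m)%N -> rnorm ((u n).1 - (u m).1) + (u m).2 <= (u n).2.
  elim: m => [|m IH]; first by rewrite leqn0 => /eqP->; rewrite subrr rnorm0 add0r.
  rewrite leq_eqVlt => /predU1P[->|]; first by rewrite subrr rnorm0 add0r.
  rewrite ltnS => /IH; apply: le_trans; have [_ _ um _ _] := un m.
  have um1 := rnorm_triangle (u m).1 (u n).1 (u m.+1).1.
  by rewrite (le_trans (lerD um1 (lexx _)))// -addrA lerD2l.
have [|l ul] := @rnorm_cauchy _ _ (fun n => (u n).1).
  move=> e e0.
  have [N _ Nlt] := @near_infty_natSinv_lt R (PosNum (divr_gt0 e0 (ltr0n R 2))).
  exists N.+1 => n m Nn Nm; have /= := Nlt N (leqnn N).
  have [_ + _ _ _] := un N; have := nested _ _ Nn; have := nested _ _ Nm.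
  have := u0 n; have := u0 m; have := rnorm_triangle (u N.+1).1 (u n).1 (u m).1.
  rewrite (rnormBC (u n).1 (u N.+1).1); move: (N.+1%:R^-1) => k; lra.
have inball n : rnorm ((u n).1 - l) <= (u n).2.
  apply/ler_addgt0Pr => e e0; have [N _ Nl] := ul e e0.
  have := Nl (maxn N n) (leq_maxl _ _); have := nested _ _ (leq_maxr N n).
  have := u0 (maxn N n); have := rnorm_triangle (u (maxn N n)).1 (u n).1 l.
  by rewrite (rnormBC l); lra.
have /cvg_rnormP/(_ 1 ltr01)/near_right0P[d d0 dl] := T0 l.
have bnd t : 0 <= t -> t < d -> rnorm (T t l) <= rnorm (T 0 l) + 1.
  rewrite le_eqVlt => /predU1P[<- _|t0 td]; first by rewrite lerDl.
  by have := dl t t0 td; have := rnormD (T t l - T 0 l) (T 0 l);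
    rewrite subrK rnormBC; lra.
have [N _ Nlt] := @near_infty_natSinv_lt R (PosNum d0).
pose n := maxn N (Num.truncn (rnorm (T 0 l) + 1)).+1.
have [_ _ _ /andP[t0 tn] /(_ l (inball _))] := un n.
apply/negP; rewrite -leNgt (le_trans (bnd _ t0 _))//.
  by rewrite (lt_trans tn)//; exact: (Nlt n (leq_maxl _ _)).
by rewrite ltW// (lt_le_trans (truncnS_gt _))// ler_nat leq_maxr.
Qed.

Lemma semigroup_bounded T : degenerate_semigroup T -> forall tau : R,
  exists2 M, 0 < M & forall t x, 0 <= t <= tau -> rnorm (T t x) <= M * rnorm x.
Proof.
move=> sgT tau; have [d d0 [M M1 TM]] := semigroup_near0_bounded sgT.
have [_ Tadd _] := sgT.
have M0 : 0 < M by rewrite (lt_le_trans _ M1).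
have pow (n : nat) t x : 0 <= t -> t <= n%:R * (d / 2) -> rnorm (T t x) <= M ^+ n.+1 * rnorm x.
  elim: n t x => [|n IH] t x t0 tn.
    by rewrite TM// (le_lt_trans tn)// mul0r.
  have [td|td] := leP t (d / 2).
    rewrite (le_trans (TM _ _ t0 _))//; first by move: d0 td; lra.
    rewrite ler_wpM2r ?rnorm_ge0// exprS ler_peMr ?(ltW M0)//.
    by rewrite exprn_ege1.
  have -> : t = (t - d / 2) + d / 2 by rewrite subrK.
  have d2 : 0 <= d / 2 by rewrite ltW// divr_gt0.
  rewrite Tadd ?subr_ge0 ?(ltW td)//; apply: (le_trans (IH _ _ _ _)).
  - by rewrite subr_ge0 ltW.
  - by rewrite lerBlDr -[X in _ + X]mul1r -mulrDl natr1.
  - rewrite [M ^+ n.+2]exprSr -mulrA ler_wpM2l ?exprn_ge0 ?(ltW M0)//.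
    by rewrite TM//; move: d0; lra.
pose n := (Num.truncn (tau / (d / 2))).+1.
exists (M ^+ n.+1) => [|t x /andP[t0 ttau]]; first by rewrite exprn_gt0.
apply: pow => //; apply: (le_trans ttau); rewrite -ler_pdivrMr ?divr_gt0//.
by rewrite ltW// truncnS_gt.
Qed.

End SemigroupBound.

(** * Orbits of generators, and contractions *)

Section Orbits.
Variables (R : realType) (X : completeNormedModType R[i]).
Local Notation C := R[i].
Local Open Scope complex_scope.
Implicit Types (T : R -> {linear X -> X}) (x y : X).

Lemma semigroup0 T : degenerate_semigroup T ->
  (forall t x, 0 <= t -> T t (T 0 x) = T t x) *
  (forall t x, 0 <= t -> T 0 (T t x) = T t x).
Proof.
move=> [_ Tadd _]; split=> t x t0.
  by rewrite -Tadd// addr0.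
by rewrite -Tadd// add0r.
Qed.

Lemma semigroup_comm T s t x : degenerate_semigroup T -> 0 <= s -> 0 <= t ->
  T s (T t x) = T t (T s x).
Proof. by move=> [_ Tadd _] s0 t0; rewrite -!Tadd// addrC. Qed.

Lemma generator_range T x b : degenerate_semigroup T ->
  regular_generator T (x, b) -> T 0 x = x.
Proof. by move=> sgT [[z _ /= <-] _]; rewrite (semigroup0 sgT).1. Qed.

(** The definition of the generator as a first-order expansion, without quotients. *)
Lemma generator_nearP T x b : degenerate_semigroup T ->
  regular_generator T (x, b) -> forall e : R, 0 < e ->
  \forall h \near 0^'+, rnorm (T h x - x - h%:C *: b) <= e * h.
Proof.
move=> sgT [_ /= /cvg_rnormP xb] e e0; near=> h.
have h0 : 0 < h by near: h; exact: nbhs_right_gt.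
have -> : T h x - x - h%:C *: b = h%:C *: ((h^-1)%:C *: (T h x - x) - b).
  by rewrite scalerBr scalerA -rmorphM divff ?gt_eqF// scale1r.
rewrite rnormZr ?(ltW h0)// mulrC ler_wpM2r ?(ltW h0)// rnormBC ltW//.
near: h; exact: xb.
Unshelve. all: by end_near. Qed.

Lemma generator_orbit T x b s : degenerate_semigroup T ->
  regular_generator T (x, b) -> 0 <= s ->
  regular_generator T (T s x, T s b).
Proof.
move=> sgT xb s0; split; first by exists (T s x) => //=; rewrite (semigroup0 sgT).2.
have [_ /= xb2] := xb; have [Tc _ _] := sgT.
have := cvg_comp _ _ xb2 (Tc s s0 b); apply: cvg_trans; apply: near_eq_cvg.
near=> h; have h0 : 0 < h by near: h; exact: nbhs_right_gt.
by rewrite /= linearZ linearB /= (semigroup_comm _ sgT (ltW h0) s0).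
Unshelve. all: by end_near. Qed.

Lemma semigroup_right_cvg T x e : degenerate_semigroup T -> 0 < e ->
  \forall h \near 0^'+, rnorm (T h x - T 0 x) < e.
Proof.
move=> [_ _ T0] e0; have /cvg_rnormP/(_ e e0) := T0 x.
by apply: filterS => h; rewrite rnormBC.
Qed.

(** From [T(s) x - T(s - h) x = T(s - h) (T(h) x - T(0) x)] and the local bound:
continuity from the left is a consequence of continuity at time zero. *)
Lemma semigroup_left_cvg T s x e : degenerate_semigroup T -> 0 < s -> 0 < e ->
  \forall h \near 0^'+, rnorm (T s x - T (s - h) x) < e.
Proof.
move=> sgT s0 e0; have [M M0 TM] := semigroup_bounded sgT s.
have eM : 0 < e / M by rewrite divr_gt0.
near=> h.
have h0 : 0 < h by near: h; exact: nbhs_right_gt.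
have hs : h <= s by near: h; exact: nbhs_right_le.
have sh : 0 <= s - h by rewrite subr_ge0.
have -> : T s x - T (s - h) x = T (s - h) (T h x - T 0 x).
  have [_ Tadd _] := sgT.
  by rewrite linearB /= (semigroup0 sgT).1// -Tadd ?(ltW h0)// subrK.
rewrite (le_lt_trans (TM _ _ _))//; first by rewrite sh lerBlDr lerDl ltW.
rewrite mulrC -ltr_pdivlMr//; near: h; exact: semigroup_right_cvg.
Unshelve. all: by end_near. Qed.

End Orbits.

Section Contraction.
Variables (R : realType) (H : hilbertType R).
Local Notation C := R[i].
Local Open Scope complex_scope.

(** The right derivative of [|T(t) x|^2] is [2 Re (T(t) b | T(t) x)], which is not
positive. *)
Lemma dissipative_contraction (T : R -> {linear H -> H}) :
  degenerate_semigroup T ->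
  (forall x b, regular_generator T (x, b) -> complex.Re (hdot b x) <= 0) ->
  forall x b t, regular_generator T (x, b) -> 0 <= t -> rnorm (T t x) <= rnorm x.
Proof.
move=> sgT Tdis x b t xb t0.
rewrite -(@ler_pXn2r _ 2)// ?nnegrE ?rnorm_ge0//.
have -> : rnorm x ^+ 2 = rnorm (T 0 x) ^+ 2 + 0 * t.
  by rewrite mul0r addr0 (generator_range sgT xb).
apply: (@dini_mean_value _ (fun s => rnorm (T s x) ^+ 2)) => // s e.
- move=> /andP[s0 st] e0; rewrite add0r.
  have yb := generator_orbit sgT xb s0.
  have := Tdis _ _ yb; set y := T s x; set c := T s b => cy.
  (* If the remainder of the first-order expansion of [T h y] is at most [k h],
     the squared norm grows by at most [h k (2 |y| + (1 + |c|)^2)]. *)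
  pose k := Num.min 1 (e / (2 * (rnorm y + 1) + (1 + rnorm c) ^+ 2)).
  have y0 := rnorm_ge0 y; have c0 := rnorm_ge0 c.
  have den : 0 < 2 * (rnorm y + 1) + (1 + rnorm c) ^+ 2.
    by rewrite ltr_pwDl ?sqr_ge0// mulr_gt0// ltr_wpDl.
  have k0 : 0 < k by rewrite lt_min ltr01 divr_gt0.
  have k1 : k <= 1 by rewrite ge_min lexx.
  have kd : k * (2 * (rnorm y + 1) + (1 + rnorm c) ^+ 2) <= e.
    by rewrite -ler_pdivlMr// ge_min lexx orbT.
  near=> h.
  have h0 : 0 < h by near: h; exact: nbhs_right_gt.
  have hk : h <= k by near: h; exact: nbhs_right_le.
  have est : rnorm (T h y - y - h%:C *: c) <= k * h.
    by near: h; exact: generator_nearP.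
  have -> : T (s + h) x = T h y.
    by have [_ Tadd _] := sgT; rewrite addrC Tadd// ltW.
  set r := T h y - y - h%:C *: c in est.
  have -> : T h y = y + (h%:C *: c + r) by rewrite /r [X in y + X]addrC subrK addrC subrK.
  have w_le : rnorm (h%:C *: c + r) <= h * (1 + rnorm c).
    rewrite (le_trans (rnormD _ _))// rnormZr ?(ltW h0)//.
    have : k * h <= 1 * h by rewrite ler_wpM2r ?(ltW h0).
    by move: est; lra.
  have w2 : rnorm (h%:C *: c + r) ^+ 2 <= h * (k * (1 + rnorm c) ^+ 2).
    apply: (@le_trans _ _ ((h * (1 + rnorm c)) ^+ 2)).
      by rewrite ler_pXn2r// nnegrE ?rnorm_ge0// mulr_ge0 ?(ltW h0)// addr_ge0.
    by rewrite exprMn expr2 -mulrA ler_wpM2l ?(ltW h0)// ler_wpM2r ?sqr_ge0.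
  have yr : complex.Re (hdot y r) <= rnorm y * (k * h).
    rewrite (le_trans (ler_norm _))// (le_trans (Re_le_rnorm _))//.
    by rewrite (le_trans (cauchy_schwarz _ _))// ler_wpM2l.
  have yc : complex.Re (hdot y (h%:C *: c)) <= 0.
    by rewrite hdotZr conj_real ReZ Re_hdotC mulr_ge0_le0 ?(ltW h0).
  have keh := ler_wpM2r (ltW h0) kd.
  have kh0 : 0 <= k * h by rewrite mulr_ge0 ?(ltW h0) ?(ltW k0).
  rewrite rnormD2 hdotDr ReD; move: w2 yr yc keh kh0.
  by rewrite [h * (k * _)]mulrA [h * k]mulrC; lra.
- move=> /andP[s0 st] e0; pose n := rnorm (T s x).
  have n0 : 0 <= n := rnorm_ge0 _.
  have n1 : 0 < 2 * n + 1 by rewrite ltr_wpDl// mulr_ge0.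
  apply: filterS (semigroup_left_cvg x sgT s0 (divr_gt0 e0 n1)) => h.
  rewrite ltr_pdivlMr// -/n => Th.
  set m := rnorm (T (s - h) x); have m0 : 0 <= m := rnorm_ge0 _.
  have [nm|mn] := lerP n m.
    by rewrite (@le_trans _ _ (m ^+ 2))// ?lerDl ?(ltW e0)// ler_pXn2r.
  have nm : n - m <= rnorm (T s x - T (s - h) x).
    by have := rnormD (T s x - T (s - h) x) (T (s - h) x); rewrite subrK -/n -/m; lra.
  have : (n - m) * (2 * n + 1) <= e.
    by rewrite (le_trans _ (ltW Th))// ler_wpM2r// ltW.
  have : 0 <= (n - m) * (n - m) by rewrite -expr2 sqr_ge0.
  by move: mn; lra.
Unshelve. all: by end_near. Qed.

End Contraction.

(** * Trotter-Kato approximation *)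

Section TrotterKato.
Variables (R : realType) (X : completeNormedModType R[i]).
Local Notation C := R[i].
Local Open Scope complex_scope.
Implicit Types (S : R -> {linear X -> X}) (Q : {linear X -> X}) (x y z : X).

(** If [- G] is the single-valued generator of [S] on the range of [S 0], the last
clause reads [(1 + G) Q = S 0]: there [Q] is the resolvent of [G] at [1], and it
vanishes on the kernel of [S 0]. *)
Definition contraction_with_resolvent S Q :=
  [/\ degenerate_semigroup S,
      forall t x, 0 <= t -> rnorm (S t x) <= rnorm x,
      forall x, rnorm (Q x) <= rnorm x,
      forall t x, 0 <= t -> Q (S t x) = S t (Q x) &
      forall x, regular_generator S (Q x, Q x - S 0 x)].

Lemma resolvent_absorb S Q x : contraction_with_resolvent S Q ->
  (S 0 (Q x) = Q x) * (Q (S 0 x) = Q x).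
Proof.
move=> [sgS _ _ QS Qgen].
have SQ : S 0 (Q x) = Q x := generator_range sgS (Qgen x).
by split=> //; rewrite QS.
Qed.

Section Pair.
Variables (S S' : R -> {linear X -> X}) (Q Q' : {linear X -> X}).
Hypothesis SQ : contraction_with_resolvent S Q.
Hypothesis SQ' : contraction_with_resolvent S' Q'.
Hypothesis ker_sub : forall x, S 0 x = 0 -> S' 0 x = 0.

(** [S' 0] vanishes on the range of [1 - S 0]. *)
Lemma kernel_absorb t x : 0 <= t -> S' t (S 0 x) = S' t x.
Proof.
move=> t0; have [sgS _ _ _ _] := SQ; have [sgS' _ _ _ _] := SQ'.
apply/eqP; rewrite -subr_eq0 -linearB /= -[S' t _](semigroup0 sgS').1//.
rewrite ker_sub ?linear0//.
by rewrite linearB /= (semigroup0 sgS).1// subrr.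
Qed.

(** Along [f s = S'(t - s) Q' S(s) Q y] the terms that involve the generators cancel
up to [S'(0) (Q - Q') S(s) y], so that [kappa] bounds the right derivative of
[f]. Both semigroups being contractions, the increments of [f] are estimated
without differentiating the product of operators. *)
Lemma trotter_kato_estimate y t kappa : 0 <= t -> 0 <= kappa ->
  (forall s, 0 <= s <= t -> rnorm (Q (S s y) - Q' (S s y)) <= kappa) ->
  rnorm (Q' (S t (Q y)) - S' t (Q' (Q y))) <= kappa * t.
Proof.
move=> t0 kappa0 Qk.
have [sgS Sc Qc QS Qgen] := SQ; have [sgS' Sc' Qc' QS' Qgen'] := SQ'.
pose f s := S' (t - s) (Q' (S s (Q y))).
have -> : Q' (S t (Q y)) = f t by rewrite /f subrr (resolvent_absorb _ SQ').1.
have -> : S' t (Q' (Q y)) = f 0 by rewrite /f subr0 (resolvent_absorb _ SQ).1.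
have stepf s h : 0 <= s -> 0 <= h -> s + h <= t ->
    rnorm (f (s + h) - f s) <=
      rnorm (Q' (S h (S s (Q y))) - S' h (Q' (S s (Q y)))).
  move=> s0 h0 sht; have [_ Sadd _] := sgS; have [_ Sadd' _] := sgS'.
  have d0 : 0 <= t - (s + h) by rewrite subr_ge0.
  have -> : f (s + h) - f s =
      S' (t - (s + h)) (Q' (S h (S s (Q y))) - S' h (Q' (S s (Q y)))).
    rewrite linearB /= -Sadd// -Sadd'// [h + s]addrC /f; congr (_ - S' _ _).
    by rewrite opprD addrA subrK.
  exact: Sc'.
apply: vector_dini_mean_value => // s e.
- move=> /andP[s0 st] e0; pose z := S s y.
  have Qz : S s (Q y) = Q z by rewrite /z QS.
  have e2 : 0 < e / 2 by rewrite divr_gt0.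
  near=> h.
  have h0 : 0 < h by near: h; exact: nbhs_right_gt.
  have sht : s + h <= t.
    by rewrite addrC -lerBrDr; near: h; apply: nbhs_right_le; rewrite subr_gt0.
  rewrite (le_trans (stepf _ _ s0 (ltW h0) sht))// Qz.
  have e3 : rnorm (S h (Q z) - Q z - h%:C *: (Q z - S 0 z)) <= e / 2 * h.
    by near: h; exact: (generator_nearP sgS (Qgen z) e2).
  have e4 : rnorm (S' h (Q' (Q z)) - Q' (Q z) - h%:C *: (Q' (Q z) - S' 0 (Q z)))
      <= e / 2 * h.
    by near: h; exact: (generator_nearP sgS' (Qgen' (Q z)) e2).
  pose r := S h (Q z) - Q z - h%:C *: (Q z - S 0 z).
  pose r' := S' h (Q' (Q z)) - Q' (Q z) - h%:C *: (Q' (Q z) - S' 0 (Q z)).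
  have -> : Q' (S h (Q z)) - S' h (Q' (Q z)) =
      h%:C *: S' 0 (Q z - Q' z) + (Q' r - r').
    have -> : S h (Q z) = Q z + h%:C *: (Q z - S 0 z) + r.
      by rewrite /r -[S h (Q z) - _ - _]addrA -opprD [X in _ = X]addrC subrK.
    have -> : S' h (Q' (Q z)) = Q' (Q z) + h%:C *: (Q' (Q z) - S' 0 (Q z)) + r'.
      by rewrite /r' -[S' h _ - _ - _]addrA -opprD [X in _ = X]addrC subrK.
    have Q'S : Q' (S 0 z) = Q' z.
      rewrite -[Q' (S 0 z)](resolvent_absorb _ SQ').2 kernel_absorb//.
      by rewrite (resolvent_absorb _ SQ').2.
    rewrite [Q' (_ + r)]linearD /= [Q' (_ + h%:C *: _)]linearD /= linearZ /=.
    rewrite [Q' (_ - S 0 z)]linearB /= Q'S [S' 0 (_ - _)]linearB /=.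
    rewrite (resolvent_absorb _ SQ').1 !scalerBr.
    move: (Q' (Q z)) (h%:C *: Q' (Q z)) (h%:C *: Q' z) (h%:C *: S' 0 (Q z)) => a b c k.
    rewrite opprD addrACA; congr (_ + _).
    by rewrite opprD addrACA subrr add0r opprB addrC addrA subrK.
  rewrite (le_trans (rnormD _ _))// rnormZr ?(ltW h0)//.
  have w_le : h * rnorm (S' 0 (Q z - Q' z)) <= kappa * h.
    rewrite mulrC ler_wpM2r ?(ltW h0)// (le_trans (Sc' _ _ _))// Qk// s0 ltW//.
  have := rnormB (Q' r) r'; have := Qc' r; rewrite mulrDl.
  by move: e3 e4 w_le; rewrite -/r -/r'; lra.
- move=> /andP[s0 st] e0.
  have e2 : 0 < e / 2 by rewrite divr_gt0.
  have v0 : S' 0 (Q' (S s (Q y))) = Q' (S s (Q y)) := (resolvent_absorb _ SQ').1.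
  near=> h.
  have h0 : 0 < h by near: h; exact: nbhs_right_gt.
  have hs : h <= s by near: h; exact: nbhs_right_le.
  have sh : 0 <= s - h by rewrite subr_ge0.
  have e3 : rnorm (S s (Q y) - S (s - h) (Q y)) < e / 2.
    by near: h; exact: semigroup_left_cvg.
  have e4 : rnorm (S' h (Q' (S s (Q y))) - S' 0 (Q' (S s (Q y)))) < e / 2.
    by near: h; exact: semigroup_right_cvg.
  have := stepf (s - h) h sh (ltW h0); rewrite subrK => /(_ st) /le_trans; apply.
  have [_ Sadd _] := sgS; rewrite -Sadd ?(ltW h0)// [h + _]addrC subrK.
  apply: (le_trans (rnorm_triangle (S' h (Q' (S s (Q y)))) _ _)).
  rewrite -linearB /= -linearB /= rnormBC.
  have := le_trans (Sc' h (Q' (S s (Q y) - S (s - h) (Q y))) (ltW h0)) (Qc' _).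
  by move: e3 e4; rewrite v0; lra.
Unshelve. all: by end_near. Qed.

End Pair.
End TrotterKato.

Section TrotterKatoConvergence.
Variables (R : realType) (X : completeNormedModType R[i]).
Local Notation C := R[i].
Local Open Scope complex_scope.
Variables (S : R -> {linear X -> X}) (Q : {linear X -> X}).
Variables (S_ : nat -> R -> {linear X -> X}) (Q_ : nat -> {linear X -> X}).
Hypothesis SQ : contraction_with_resolvent S Q.
Hypothesis SQ_ : forall n, contraction_with_resolvent (S_ n) (Q_ n).
Hypothesis ker_sub : forall n x, S 0 x = 0 -> S_ n 0 x = 0.
Hypothesis Q_cvg : forall y (e : R), 0 < e ->
  \forall n \near \oo, rnorm (Q_ n y - Q y) < e.
Hypothesis Q_dense : forall x (e : R), 0 < e -> exists y, rnorm (S 0 x - Q y) < e.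

(** Contractivity makes the modulus of continuity of an orbit at time zero a modulus
at all times. *)
Lemma orbit_equicontinuous y e : 0 < e -> exists2 d : R, 0 < d &
  forall s t, 0 <= s -> 0 <= t -> `|s - t| < d -> rnorm (S s y - S t y) < e.
Proof.
move=> e0; have [sgS Sc _ _ _] := SQ; have [_ Sadd _] := sgS.
have /near_right0P[d d0 dS] := semigroup_right_cvg y sgS e0.
have le_case s t : 0 <= s -> s <= t -> t - s < d -> rnorm (S t y - S s y) < e.
  move=> s0; rewrite le_eqVlt => /predU1P[-> _|st td]; first by rewrite subrr rnorm0.
  have -> : S t y - S s y = S s (S (t - s) y - S 0 y).
    rewrite linearB /= (semigroup0 sgS).1// -Sadd ?subr_ge0 ?(ltW st)//.
    by rewrite [s + _]addrC subrK.
  by rewrite (le_lt_trans (Sc _ _ s0))// dS// subr_gt0.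
exists d => // s t s0 t0; have [st|ts] := leP s t.
  by rewrite distrC rnormBC ger0_norm ?subr_ge0//; exact: le_case.
by rewrite ger0_norm ?subr_ge0 ?(ltW ts)//; apply: le_case => //; exact: ltW.
Qed.

(** Strong convergence of contractions is uniform on compact sets. *)
Lemma resolvent_cvg_orbit y (tau e : R) : 0 < e -> \forall n \near \oo,
  forall s, 0 <= s <= tau -> rnorm (Q (S s y) - Q_ n (S s y)) < e.
Proof.
move=> e0; have [_ _ Qc _ _] := SQ.
have e3 : 0 < e / 3 by rewrite divr_gt0.
have [d d0 dS] := orbit_equicontinuous y e3.
have := iffLR (compact_near_coveringP _) (@segment_compact R 0 tau).
move/(iffRL (near_covering_withinP _)) => /(_ nat \oo
  (fun n s => rnorm (Q (S s y) - Q_ n (S s y)) < e) _) cov.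
have : forall s, `[0, tau]%classic s -> \forall s' \near s & n \near \oo,
    `[0, tau]%classic s' -> rnorm (Q (S s' y) - Q_ n (S s' y)) < e.
  move=> s /=; rewrite in_itv/= => /andP[s0 stau].
  have [N _ hN] := Q_cvg (S s y) e3.
  exists ([set s' | `|s - s'| < d], [set n | (N <= n)%N]).
    by split; [exact: nbhsx_ballx|exists N].
  move=> [s' n] [/= ss' Nn]; rewrite in_itv/= => /andP[s'0 _].
  have h1 := dS s s' s0 s'0 ss'; have h2 := hN n Nn.
  have [_ _ Qc' _ _] := SQ_ n.
  have h3 := Qc (S s' y - S s y); have h4 := Qc' (S s y - S s' y).
  have -> : Q (S s' y) - Q_ n (S s' y) =
      Q (S s' y - S s y) + (Q (S s y) - Q_ n (S s y)) + Q_ n (S s y - S s' y).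
    by rewrite !linearB /= !addrA !subrK.
  have := rnormD (Q (S s' y - S s y) + (Q (S s y) - Q_ n (S s y))) (Q_ n (S s y - S s' y)).
  have := rnormD (Q (S s' y - S s y)) (Q (S s y) - Q_ n (S s y)).
  move: h2 h3; rewrite (rnormBC (S s' y)) (rnormBC (Q_ n (S s y)) (Q (S s y))).
  by move: h1 h4; lra.
move/cov; apply: filterS => n nP s s0; apply: nP.
by rewrite /= in_itv.
Qed.

(** [trotter_kato_estimate] yields the convergence on vectors [Q (Q z)]. These are
dense in the range of [S 0] because [Q y = Q (S 0 y)], and on the kernel of
[S 0] all the semigroups vanish. *)
Theorem trotter_kato x (tau e : R) : 0 < e -> \forall n \near \oo,
  forall t, 0 <= t <= tau -> rnorm (S_ n t x - S t x) < e.
Proof.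
move=> e0; have [sgS Sc Qc QS _] := SQ.
have e8 : 0 < e / 8 by rewrite divr_gt0.
have [y xy] := Q_dense x e8.
have [z yz] := Q_dense y e8.
have QQz : rnorm (Q y - Q (Q z)) < e / 8.
  by rewrite -(resolvent_absorb y SQ).2 -linearB (le_lt_trans (Qc _)).
have k0 : 0 < e / 8 / (1 + `|tau|) by rewrite divr_gt0// ltr_pwDl.
have h1 := resolvent_cvg_orbit z tau k0.
have h2 := resolvent_cvg_orbit (Q z) tau e8.
have h3 := Q_cvg (Q z) e8.
apply: filterS3 h1 h2 h3 => n h1 h2 h3 t /[dup] ht /andP[t0 ttau].
have [sgS' Sc' Qc' QS' _] := SQ_ n.
pose v := Q (Q z).
have est : rnorm (Q_ n (S t (Q z)) - S_ n t (Q_ n (Q z))) <= e / 8.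
  apply: (@le_trans _ _ (e / 8 / (1 + `|tau|) * t)).
    apply: (trotter_kato_estimate SQ (SQ_ n) (@ker_sub n)) => //; first exact: ltW.
    by move=> s /andP[s0 st]; apply/ltW/h1; rewrite s0 (le_trans st).
  rewrite -mulrA ler_piMr ?(ltW e8)// mulrC ler_pdivrMr ?ltr_pwDl// mul1r.
  by rewrite (le_trans ttau)// (le_trans (ler_norm _))// lerDr.
have vx : rnorm (S 0 x - v) < e / 4.
  by have := rnorm_triangle (Q y) (S 0 x) v; move: xy QQz; rewrite -/v; lra.
have h4 : rnorm (S_ n t v - S_ n t (Q_ n (Q z))) < e / 8.
  by rewrite -linearB (le_lt_trans (Sc' _ _ t0))// rnormBC.
have h5 : rnorm (Q_ n (S t (Q z)) - S t v) < e / 8.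
  by rewrite rnormBC /v -QS// h2.
have h6 : rnorm (S_ n t x - S_ n t v) < e / 4.
  by rewrite -(kernel_absorb SQ (SQ_ n) (@ker_sub n))// -linearB (le_lt_trans (Sc' _ _ t0)).
have h7 : rnorm (S t x - S t v) < e / 4.
  by rewrite -[S t x](semigroup0 sgS).1// -linearB (le_lt_trans (Sc _ _ t0)).
have := rnorm_triangle (S_ n t v) (S_ n t x) (S t x).
have := rnorm_triangle (S t v) (S_ n t v) (S t x).
have := rnorm_triangle (S_ n t (Q_ n (Q z))) (S_ n t v) (S t v).
have := rnorm_triangle (Q_ n (S t (Q z))) (S_ n t (Q_ n (Q z))) (S t v).
rewrite (rnormBC _ (Q_ n (S t (Q z)))) (rnormBC (S t v) (S t x)).
move: est h4 h5 h6 h7; lra.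
Qed.

End TrotterKatoConvergence.

(** * Exponential rescaling *)

Section Rescaling.
Variables (R : realType) (X : completeNormedModType R[i]).
Local Notation C := R[i].
Local Open Scope complex_scope.
Implicit Types (T : R -> {linear X -> X}) (x y b : X).

Lemma lmapD (f : {linear X -> X}) x y : f (x + y) = f x + f y.
Proof. exact: linearD. Qed.

Lemma lmapB (f : {linear X -> X}) x y : f (x - y) = f x - f y.
Proof. exact: linearB. Qed.

Lemma lmapN (f : {linear X -> X}) x : f (- x) = - f x.
Proof. exact: linearN. Qed.

(** Multiplying by [e^{g t}] adds [g] to the generator; for the vertex [g] of the
form this leaves a semigroup of contractions. *)
Definition rescale (g : R) T (t : R) : {linear X -> X} :=
  ((expR (g * t))%:C \*: T t : {linear X -> X}).

Arguments rescale : simpl never.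

Lemma rescaleE g T t x : rescale g T t x = (expR (g * t))%:C *: T t x.
Proof. by []. Qed.

Lemma rescale0 g T x : rescale g T 0 x = T 0 x.
Proof. by rewrite rescaleE mulr0 expR0 scale1r. Qed.

Lemma rnorm_expR g t x : rnorm ((expR (g * t))%:C *: x) = expR (g * t) * rnorm x.
Proof. by rewrite rnormZr// expR_ge0. Qed.

Lemma rescaleK g T t x : rescale (- g) (rescale g T) t x = T t x.
Proof.
by rewrite !rescaleE scalerA -rmorphM -expRD mulNr addNr expR0 scale1r.
Qed.

Lemma cvg_real_complex (f : R -> R) (l : R) :
  f t @[t --> 0^'+] --> l -> ((f t)%:C : C) @[t --> 0^'+] --> (l%:C : C).
Proof.
move=> /cvgrPdist_lt fl; apply/cvg_rnormP => e e0.
by apply: filterS (fl e e0) => t; rewrite -rmorphB rnorm_real.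
Qed.

(** From [1 + u <= e^u] and [1 - u <= e^{-u}]. *)
Lemma expR_taylor1 (u : R) : `|u| <= 2^-1 -> `|expR u - 1 - u| <= 2 * u ^+ 2.
Proof.
rewrite ler_norml => /andP[u1 u2]; have h1 := expR_ge1Dx u.
have h2 := expR_ge1Dx (- u); have u0 := expR_gt0 u.
have h3 : expR u * (1 - u) <= 1.
  by rewrite (le_trans (ler_wpM2l (ltW u0) h2))// expRN divff// gt_eqF.
have h4 : (expR u - 1 - u) * (1 - u) <= u ^+ 2 by move: h3; rewrite expr2; lra.
rewrite ger0_norm; last by move: h1; lra.
rewrite -(@ler_pM2r _ (1 - u)); last by lra.
apply: (le_trans h4); rewrite -mulrA mulrCA ler_peMr ?sqr_ge0//; lra.
Qed.

Lemma cvg_expR_right (g : R) : expR (g * t) @[t --> 0^'+] --> (1 : R).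
Proof.
have gt0 : g * t @[t --> 0^'+] --> g * 0 by apply: cvgMr; exact: cvg_within.
have := cvg_comp _ _ gt0 (@continuous_expR R (g * 0)).
by rewrite (_ : expR (g * 0) = 1)// mulr0 expR0.
Qed.

Lemma cvg_expR_quotient (g : R) : (expR (g * t) - 1) / t @[t --> 0^'+] --> g.
Proof.
apply/cvgrPdist_lt => e e0.
have g0 : 0 < 1 + `|g| by rewrite ltr_pwDl.
have g20 : 0 < 1 + 2 * g ^+ 2 by rewrite ltr_pwDl// mulr_ge0// sqr_ge0.
have k0 : 0 < 2^-1 / (1 + `|g|) by rewrite divr_gt0.
have k20 : 0 < e / (1 + 2 * g ^+ 2) by rewrite divr_gt0.
near=> t.
have t0 : 0 < t by near: t; exact: nbhs_right_gt.
have tk : t < 2^-1 / (1 + `|g|) by near: t; exact: nbhs_right_lt.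
have tk2 : t < e / (1 + 2 * g ^+ 2) by near: t; exact: nbhs_right_lt.
move: tk tk2; rewrite !ltr_pdivlMr// => tk tk2.
have small : `|g * t| <= 2^-1.
  by rewrite normrM (gtr0_norm t0); move: tk; lra.
have -> : g - (expR (g * t) - 1) / t = - ((expR (g * t) - 1 - g * t) / t).
  by field; rewrite gt_eqF.
rewrite normrN normrM normfV (gtr0_norm t0) ltr_pdivrMr//.
apply: (le_lt_trans (expR_taylor1 small)).
have := ltr_pM2r t0 (t * (1 + 2 * g ^+ 2)) e; rewrite tk2 => {}tk2.
have : 0 < t * t by rewrite mulr_gt0.
by move: tk2; rewrite exprMn !expr2; lra.
Unshelve. all: by end_near. Qed.

Lemma rescale_semigroup g T : degenerate_semigroup T ->
  degenerate_semigroup (rescale g T).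
Proof.
move=> [Tc Tadd T0]; split=> [t t0 x|s t x s0 t0|x].
- by rewrite /continuous_at !rescaleE; apply: cvgZr; exact: Tc.
- rewrite !rescaleE Tadd// linearZ scalerA -rmorphM -expRD.
  by rewrite mulrDr.
- rewrite rescale0 -[T 0 x]scale1r; apply: cvgZ; last exact: T0.
  exact: cvg_real_complex (cvg_expR_right g).
Qed.

Lemma regular_generator_ext T T' p : (forall t x, T t x = T' t x) ->
  regular_generator T p -> regular_generator T' p.
Proof.
move=> TT' [[z _ zp] Tp]; split; first by exists z => //; rewrite -TT'.
apply: cvg_trans Tp; apply: near_eq_cvg; near=> t.
by rewrite TT'.
Unshelve. all: by end_near. Qed.

Lemma regular_generator_unique T x b b' : regular_generator T (x, b) ->
  regular_generator T (x, b') -> b = b'.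
Proof.
by move=> [_ xb] [_ xb']; exact: (cvg_unique _ xb xb').
Qed.

Lemma rescale_generator g T x b : degenerate_semigroup T ->
  regular_generator T (x, b) ->
  regular_generator (rescale g T) (x, b + g%:C *: x).
Proof.
move=> sgT xb; split.
  by have [[z _ /= zp] _] := xb; exists z => //; exact: etrans (rescale0 g T z) zp.
have [_ /= xb2] := xb.
have : (expR (g * t))%:C *: ((t^-1)%:C *: (T t x - x)) +
    ((expR (g * t) - 1) / t)%:C *: x @[t --> 0^'+] --> 1 *: b + g%:C *: x.
  apply: cvgD.
    by apply: cvgZ; [exact: cvg_real_complex (cvg_expR_right g)|exact: xb2].
  apply: cvgZ; last exact: cvg_cst.
  exact: (cvg_real_complex (@cvg_expR_quotient g)).
rewrite scale1r; apply: cvg_trans; apply: near_eq_cvg; near=> t.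
rewrite /= scalerA [(expR _)%:C * _]mulrC -scalerA rmorphM /=.
rewrite [_ * (t^-1)%:C]mulrC -scalerA -scalerDr; congr (_ *: _).
by rewrite rmorphB /= scalerBr scalerBl scale1r addrA subrK.
Unshelve. all: by end_near. Qed.

End Rescaling.

(** * The semigroup of a form *)

Section FormSemigroup.
Variables (R : realType) (H : hilbertType R) (E : lmodType R[i]).
Local Notation C := R[i].
Local Open Scope complex_scope.
Variables (gamma : R) (a : E -> E -> C) (j : E -> H) (A B : set (H * H)).
Variables (T : R -> {linear H -> H}) (Q : {linear H -> H}).
Hypothesis b_ge0 : forall u, 0 <= complex.Re (shift_form gamma a j u u).
Hypothesis BA : associated_sectorial (shift_form gamma a j) j B.
Hypothesis AE : A = [set (p.1, p.2 + gamma%:C *: p.1) | p in B].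
Hypothesis sgT : degenerate_semigroup T.
Hypothesis genT : generator T = opp_relation A.
Hypothesis resQ : is_resolvent (shift_form gamma a j) j B Q.

Let S := rescale gamma T.
Let sgS : degenerate_semigroup S := rescale_semigroup gamma sgT.

Lemma regular_generator_T x b : regular_generator S (x, b) ->
  regular_generator T (x, b - gamma%:C *: x).
Proof.
move=> /(rescale_generator (- gamma) sgS); rewrite rmorphN scaleNr.
by apply: regular_generator_ext => t y; exact: rescaleK.
Qed.

Lemma regular_generator0 : regular_generator S (0, 0).
Proof.
split; first by exists 0 => //; exact: linear0.
apply: (cvg_trans _ (@cvg_cst _ (0 : H) _ (0^'+ : set_system R) _)).
apply: near_eq_cvg; near=> t.
by rewrite /= !(linear0, scaler0, subr0).
Unshelve. all: by end_near. Qed.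

Lemma regular_generator_fixed x b : regular_generator S (x, b) -> S 0 b = b.
Proof.
move=> xb; have := generator_orbit sgS xb (lexx 0).
rewrite (generator_range sgS xb) => xb2.
exact: (regular_generator_unique xb2 xb).
Qed.

Lemma generator_form x b : regular_generator S (x, b) -> B (x, - b).
Proof.
move=> /regular_generator_T xb.
have : generator T (x, b - gamma%:C *: x).
  exists (b - gamma%:C *: x), 0; split => //; last by rewrite /= addr0.
  by exists 0; rewrite // linear0 subr0.
rewrite genT AE => -[_ [[x' z] Bxz <-] /= [x'x zE]].
rewrite -x'x (_ : - b = z)//.
apply: oppr_inj; rewrite opprK; move: zE; rewrite -x'x opprD.
by move/(congr1 (fun w => w + gamma%:C *: x')); rewrite !subrK.
Qed.

(** The generator is single-valued only after projecting onto the range of [S 0]. *)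
Lemma form_generator x z : B (x, z) -> regular_generator S (x, - S 0 z).
Proof.
move=> Bxz; have : generator T (x, - (z + gamma%:C *: x)).
  rewrite genT AE; exists (x, z + gamma%:C *: x) => //.
  by exists (x, z).
move=> [b [y [/= xb [w _ yE] zE]]].
have xbS := rescale_generator gamma sgT xb.
have Sx := generator_range sgS xbS.
have Sy : S 0 y = 0.
  have Tw : T 0 w = S 0 w by rewrite /S rescale0.
  by rewrite -yE Tw lmapB ?(semigroup0 sgS).1// subrr.
suff -> : - S 0 z = b + gamma%:C *: x by [].
rewrite -(regular_generator_fixed xbS) -lmapN.
have -> : - z = b + gamma%:C *: x + y.
  by rewrite addrAC -zE opprD subrK.
by rewrite lmapD Sy addr0.
Qed.

Lemma kernelP y : S 0 y = 0 <-> B (0, y).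
Proof.
split=> [Sy|/form_generator Sy].
  have : generator T (0, - y).
    exists 0, (- y); split; last by rewrite /= add0r.
      by have := regular_generator_T regular_generator0; rewrite scaler0 subr0.
    by exists (- y); rewrite // lmapN -(rescale0 gamma) Sy oppr0 subr0.
  rewrite genT AE => -[_ [[x' z] Bxz <-] /= [x'x zE]].
  rewrite (_ : y = z) -?x'x//.
  by apply: oppr_inj; rewrite -zE x'x scaler0 addr0.
by apply/oppr_inj; rewrite oppr0; exact: regular_generator_unique Sy regular_generator0.
Qed.

Lemma resolvent_generator y : regular_generator S (Q y, Q y - S 0 y).
Proof.
have [QB _ _ _] := resQ; have QyS := form_generator (QB y).
by have := QyS; rewrite lmapB (generator_range sgS QyS) opprB.
Qed.

Lemma resolvent_fixed y : S 0 (Q y) = Q y.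
Proof. exact: generator_range sgS (resolvent_generator y). Qed.

Lemma resolvent_contraction y : rnorm (Q y) <= rnorm y.
Proof.
have [QB _ _ _] := resQ; have := associated_accretive b_ge0 BA (QB y).
rewrite hdotBl ReB Re_hdot subr_ge0 => h.
have [Q0|Q0] := eqVneq (rnorm (Q y)) 0; first by rewrite Q0 rnorm_ge0.
have Qp : 0 < rnorm (Q y) by rewrite lt_def Q0 rnorm_ge0.
rewrite -(ler_pM2r Qp) -expr2 (le_trans h)// (le_trans (ler_norm _))//.
by rewrite (le_trans (Re_le_rnorm _))// cauchy_schwarz.
Qed.

(** Split [x = m + w] with [m] in the closure of the range of [Q] and [w] orthogonal
to it. Then [(w | Q w) = 0] forces [w] into the kernel of [S 0], while [S 0]
fixes [m]. So [S 0 x = m], an orthogonal projection of [x]. *)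
Lemma range_projection x :
  closure (range Q) (S 0 x) /\ rnorm (S 0 x) <= rnorm x.
Proof.
have sM : subspace (closure (range Q)).
  split=> [|x1 x2 /closure_rnormP h1 /closure_rnormP h2|c x1 /closure_rnormP h1].
  - by apply: subset_closure; exists 0 => //; exact: linear0.
  - apply/closure_rnormP => e e0; have e2 : 0 < e / 2 by rewrite divr_gt0.
    have [_ [y1 _ <-] y1e] := h1 _ e2; have [_ [y2 _ <-] y2e] := h2 _ e2.
    exists (Q (y1 + y2)); first by exists (y1 + y2).
    rewrite lmapD opprD addrACA (le_lt_trans (rnormD _ _))//.
    by move: y1e y2e; lra.
  - apply/closure_rnormP => e e0.
    have c1 : 0 < 1 + rnorm (c : C) by rewrite ltr_pwDl// rnorm_ge0.
    have [|_ [y1 _ <-] y1e] := h1 (e / (1 + rnorm (c : C))); first by rewrite divr_gt0.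
    exists (Q (c *: y1)); first by exists (c *: y1).
    rewrite linearZ /= -scalerBr rnormZ mulrC.
    move: y1e; rewrite ltr_pdivlMr//; apply: le_lt_trans.
    by rewrite ler_wpM2l ?rnorm_ge0// lerDr.
have [m Mm orth] := projection_theorem sM (@closed_closure _ _) x.
have Sw : S 0 (x - m) = 0.
  have [_ _ Qorth _] := resQ; apply/kernelP/Qorth/orth.
  by apply: subset_closure; exists (x - m).
have Sm : S 0 m = m.
  have [Sc _ _] := sgS.
  apply/eqP; rewrite -subr_eq0; apply/eqP/rnorm_le_eps => e e0.
  have e2 : 0 < e / 2 by rewrite divr_gt0.
  have [d d0 dS] := iffLR (continuous_rnormP _ _) (Sc 0 (lexx 0) m) _ e2.
  have m0 : 0 < Num.min d (e / 2) by rewrite lt_min d0.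
  have [_ [y _ <-]] := iffLR (closure_rnormP _ _) Mm _ m0.
  rewrite lt_min => /andP[/dS]; rewrite resolvent_fixed rnormBC => h1 h2.
  have := rnorm_triangle (Q y) (S 0 m) m.
  by move: h1 h2; rewrite (rnormBC _ (S 0 m)) (rnormBC (Q y) m); lra.
have Sx : S 0 x = m by rewrite -[x](subrK m) lmapD Sw add0r Sm.
rewrite Sx; split => //.
rewrite -(@ler_pXn2r _ 2)// ?nnegrE ?rnorm_ge0//.
rewrite -[x in leRHS](subrK m) rnormD2 orth// raddf0 mulr0 addr0.
by rewrite lerDr sqr_ge0.
Qed.

(** Dissipativity gives the bound on the range of [Q], and [S t] factors through the
contraction [S 0] onto the closure of this range. *)
Lemma semigroup_contraction t x : 0 <= t -> rnorm (S t x) <= rnorm x.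
Proof.
move=> t0; have [xQ Sx] := range_projection x.
rewrite -(semigroup0 sgS).1//; apply: le_trans Sx.
have [Sc _ _] := sgS.
apply/ler_addgt0Pr => e e0; have e2 : 0 < e / 2 by rewrite divr_gt0.
have [d d0 dS] := iffLR (continuous_rnormP _ _) (Sc t t0 (S 0 x)) _ e2.
have m0 : 0 < Num.min d (e / 2) by rewrite lt_min d0.
have [_ [y _ <-]] := iffLR (closure_rnormP _ _) xQ _ m0.
rewrite lt_min => /andP[/dS h1 h2].
have h3 : rnorm (S t (Q y)) <= rnorm (Q y).
  apply: (dissipative_contraction sgS) (resolvent_generator y) t0 => z b zb.
  have := associated_accretive b_ge0 BA (generator_form zb).
  by rewrite -scaleN1r hdotZl mulN1r ReN oppr_ge0.
have := rnormD (S t (S 0 x) - S t (Q y)) (S t (Q y)); rewrite subrK.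
have := rnormD (Q y - S 0 x) (S 0 x); rewrite subrK (rnormBC (Q y)).
by move: h1 h2 h3; lra.
Qed.

Theorem form_contraction : contraction_with_resolvent S Q.
Proof.
split; first exact: sgS.
- exact: semigroup_contraction.
- exact: resolvent_contraction.
- move=> t y t0; have [_ Quniq _ _] := resQ.
  have /generator_form := generator_orbit sgS (resolvent_generator y) t0.
  move/Quniq; rewrite [S t (_ - _)]lmapB (semigroup0 sgS).1// opprB addrC subrK.
  done.
- exact: resolvent_generator.
Qed.

Lemma resolvent_dense x (e : R) : 0 < e -> exists y, rnorm (S 0 x - Q y) < e.
Proof.
move=> e0; have [/closure_rnormP/(_ e e0)[_ [y _ <-] ye] _] := range_projection x.
by exists y.
Qed.

End FormSemigroup.

(** * Convergence of the semigroups *)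

Section Assembly.
Variable R : realType.
Local Notation C := R[i].
Local Open Scope complex_scope.

Lemma cvg_uniform_rnorm (X : normedModType C) (K : set R) (f_ : nat -> R -> X) (f : R -> X) :
  (forall e : R, 0 < e -> \forall n \near \oo, forall t, K t -> rnorm (f_ n t - f t) < e) ->
  {uniform K, f_ @ \oo --> f}.
Proof.
move=> ff P /uniform_nbhs[U [entU UP]].
move: entU; rewrite -entourage_ballE => -[e /= /posC_real[r r0 er] eU].
apply: filterS (ff r r0) => n nr; apply: UP => t Kt.
apply: eU => /=; rewrite -ball_normE /= er rnormE ltcR rnormBC.
exact: nr.
Qed.

End Assembly.

Theorem theorem4p1 (R : realType) (H : hilbertType R)
    (E : lmodType R[i]) (a : {sesqui E}) (j : {linear E -> H})
    (theta0 gamma : R) (htheta0 : 0 <= theta0 < pi / 2)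
    (ha : quasi_sectorial theta0 gamma a j)
    (dom_ : nat -> pred E) (F : forall n, subLmodType (dom_ n))
    (a_ : forall n, {sesqui (F n)})
    (theta : R) (htheta : 0 <= theta < pi / 2)
    (ha_ : forall n (u : F n),
       closure (sector theta) (a_ n u u - a (val u) (val u)))
    (D : {pred E}) (hD : is_core gamma a j D)
    (happrox : forall u, u \in D -> exists u_ : forall n, F n,
       form_cvg gamma a j (fun n => val (u_ n)) u /\
       a_ n (u_ n) (u_ n) - a (val (u_ n)) (val (u_ n)) @[n --> \oo]
         --> (0 : R[i]))
    (A : set (H * H)) (hA : associated gamma a j A)
    (A_ : nat -> set (H * H))
    (hA_ : forall n, associated gamma (a_ n) (fun u : F n => j (val u)) (A_ n))
    (T : R -> {linear H -> H})
    (hT : degenerate_semigroup T /\ generator T = opp_relation A)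
    (T_ : nat -> R -> {linear H -> H})
    (hT_ : forall n,
       degenerate_semigroup (T_ n) /\ generator (T_ n) = opp_relation (A_ n)) :
  forall (x : H) (K : set R), compact K -> K `<=` [set t | 0 <= t] ->
    {uniform K, (fun n t => T_ n t x) @ \oo --> (fun t => T t x)}.
Proof.
pose b := shift_form gamma a j.
pose iota n : {linear F n -> E} := val.
pose d n := diff_form (iota n) (a_ n) a.
pose bF n := shift_form gamma (a_ n) (fun u : F n => j (val u)).
have b_sect u : 0 <= complex.Re (b u u) /\
    `|complex.Im (b u u)| <= tan theta0 * complex.Re (b u u).
  by apply: closed_sector_bound; rewrite ?htheta0// /b /shift_form hdot_norm; exact: ha.
have d_sect n u : 0 <= complex.Re (d n u u) /\
    `|complex.Im (d n u u)| <= tan theta * complex.Re (d n u u).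
  by apply: closed_sector_bound; rewrite ?htheta//; exact: ha_.
have b0 u : 0 <= complex.Re (b u u) by case: (b_sect u).
have bFE n u v : bF n u v = b (iota n u) (iota n v) + d n u v.
  by rewrite /bF /b /d /shift_form /diff_form [RHS]addrC addrA subrK.
have bF0 n u : 0 <= complex.Re (bF n u u).
  by rewrite bFE ReD addr_ge0//; case: (d_sect n u).
pose c := Num.max (tan theta0) (tan theta).
pose K0 := 1 + c.
have tan0 := tan_ge0 htheta0.
have K00 : 0 < K0 by rewrite ltr_pwDl// le_max tan0.
have sK : young_bounded (graph_form b j) K0.
  apply: (@sectorial_young_bounded _ _ _ (tan theta0)); first by rewrite le_max lexx.
  move=> u; rewrite Re_graph_form; have [h1 h2] := b_sect u; split.
    by rewrite addr_ge0// sqr_ge0.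
  have -> : complex.Im (graph_form b j u u) = complex.Im (b u u).
    by rewrite /graph_form hdot_rnorm; case: (b u u) => p q /=; rewrite addr0.
  by rewrite (le_trans h2)// ler_wpM2l// lerDl sqr_ge0.
have dK n : young_bounded (d n) K0.
  apply: (@sectorial_young_bounded _ _ _ (tan theta)); last exact: d_sect.
  by rewrite le_max lexx orbT.
have approx u (e : R) : 0 < e -> exists u_ : forall n, F n,
  \forall n \near \oo,
    complex.Re (graph_form b j (u - iota n (u_ n)) (u - iota n (u_ n))) < e /\
    complex.Re (d n (u_ n) (u_ n)) < e.
  move=> e0.
  pose r := Num.sqrt (e / 4).
  have r0 : 0 < r by rewrite sqrtr_gt0 divr_gt0.
  have seminorm_lt v : form_seminorm gamma a j v < r ->
      complex.Re (graph_form b j v v) < e / 4.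
    rewrite /form_seminorm Re_semi_inner ltr_sqrt ?divr_gt0//.
    by rewrite Re_graph_form.
  have [v vD uv] := hD.2 u r r0.
  have [u_ [u_v a_v]] := happrox v vD.
  exists u_.
  have /cvgrPdist_lt/(_ r r0) h1 := u_v.
  have /cvg_rnormP/(_ e e0) h2 := a_v.
  apply: filterS2 h1 h2 => n h1 h2; split; last first.
    move: h2; rewrite sub0r rnormN; apply: le_lt_trans.
    exact: le_trans (ler_norm _) (Re_le_rnorm _).
  have h3 : form_seminorm gamma a j (val (u_ n) - v) < r.
    by apply: le_lt_trans h1; rewrite sub0r normrN ler_norm.
  have -> : u - iota n (u_ n) = (u - v) + - (val (u_ n) - v).
    by rewrite opprB addrA subrK.
  apply: (le_lt_trans (quadratic_le _ _ sK.1)); rewrite quadraticN.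
  apply: (@lt_le_trans _ _ (2 * (e / 4) + 2 * (e / 4))); last by lra.
  by rewrite ltrD// ltr_pM2l//; exact: seminorm_lt.
have [B BA AE] := hA.
have [Q resQ] := exists_resolvent b0 BA.
have /choice[B_ B_A] : forall n, exists B, associated_sectorial (bF n) (fun u : F n => j (val u)) B /\
    A_ n = [set (p.1, p.2 + gamma%:C%C *: p.1) | p in B].
  by move=> n; have [B' B'A A'E] := hA_ n; exists B'.
have /choice[Q_ resQ_] : forall n, exists Q : {linear H -> H},
    is_resolvent (bF n) (fun u : F n => j (val u)) (B_ n) Q.
  by move=> n; exact: exists_resolvent (bF0 n) (B_A n).1.
have [sgT genT] := hT.
have SQ := form_contraction b0 BA AE sgT genT resQ.
have SQ_ n := form_contraction (bF0 n) (B_A n).1 (B_A n).2 (hT_ n).1 (hT_ n).2 (resQ_ n).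
have ker_sub n x : rescale gamma T 0 x = 0 -> rescale gamma (T_ n) 0 x = 0.
  move=> /(kernelP AE sgT genT)/(associated_mul0 b0 BA) xj.
  apply/(kernelP (B_A n).2 (hT_ n).1 (hT_ n).2).
  by apply/(associated_mul0 (bF0 n) (B_A n).1) => v; exact: xj.
have Q_cvg := resolvent_cvg K00 bFE b0 sK dK approx resQ resQ_.
have Q_dense := resolvent_dense AE sgT genT resQ.
move=> x K cK K_ge0; apply: cvg_uniform_rnorm => e e0.
have [M [_ KM]] := compact_bounded cK.
pose tau := M + 1.
have Ktau t : K t -> t <= tau.
  by move=> Kt; rewrite (le_trans (ler_norm _))// (KM tau _ t Kt)// ltrDl.
(* The factor undoes the rescaling: [- gamma t <= |gamma| |tau|] on [K]. *)
have e'0 : 0 < e * expR (- (`|gamma| * `|tau|)) by rewrite mulr_gt0// expR_gt0.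
apply: filterS (trotter_kato SQ SQ_ ker_sub Q_cvg Q_dense x tau e'0) => n ST t Kt.
have t0 : 0 <= t := K_ge0 t Kt.
have := ST t; rewrite t0 Ktau// => /(_ isT).
rewrite !rescaleE -scalerBr rnorm_expR => ST_lt.
rewrite -(ltr_pM2l (expR_gt0 (gamma * t))) (lt_le_trans ST_lt)//.
rewrite mulrC ler_wpM2r ?(ltW e0)// ler_expR.
have gt_le : - (gamma * t) <= `|gamma| * `|tau|.
  rewrite -mulNr (le_trans (ler_norm _))// normrM normrN ler_wpM2l//.
  by rewrite ger0_norm// (le_trans (Ktau t Kt)) ?ler_norm.
by move: gt_le; lra.
Qed.
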